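(* Let $\mathbb K$ be a field, $R=\mathbb K[x_0,\dots,x_n]$, and let $J\subset R$ be an Artinian monomial ideal. The complete intersection locus in the marked scheme $\mathbf{Mf}_J$, i.e. the set of points of $\mathbf{Mf}_J$ corresponding to complete intersection ideals, is an open subset of $\mathbf{Mf}_J$.
   Context: $R=\mathbb K[x_0,\dots,x_n]$ has the standard grading and variables ordered $x_0<\dots<x_n$. A term is a monomial $x^\alpha$; for $x^\alpha\neq 1$, $\min(x^\alpha)$ (resp. $\max(x^\alpha)$) is the smallest (resp. largest) variable dividing it; $x_i$ is multiplicative for $x^\alpha$ if $x_i\le\min(x^\alpha)$, else non-multiplicative. Every Artinian monomial ideal $J$ has a (unique) Pommaret basis $\mathcal P_J$: a finite set of terms generating $J$ such that for every term $x^\tau\in J\setminus\mathcal P_J$ there is a unique $x^\sigma\in\mathcal P_J$ with $x^\tau=x^\delta x^\sigma$ and $\max(x^\delta)\le\min(x^\sigma)$. $\mathcal N(J)$ is the set of terms not in $J$; $\mathcal N(J)_t$ those of degree $t$. For a Noetherian $\mathbb K$-algebra $A$ put $R_A=A[x_0,\dots,x_n]$. A $\mathcal P_J$-marked set in $R_A$ is a set $\mathcal H=\{h_\alpha\}_{x^\alpha\in\mathcal P_J}$ of homogeneous polynomials such that $x^\alpha$ (the head term) occurs in $h_\alpha$ with coefficient $1$ and all other terms occurring in $h_\alpha$ lie in $\mathcal N(J)$. It is a $\mathcal P_J$-marked basis if $(R_A)_t=(\mathcal H)_t\oplus\langle\mathcal N(J)_t\rangle_A$ for every $t$. For a marked set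 every $f\in R_A$ has a unique standard representation $f=\sum_{h\in\mathcal H}P_hh+g$ with $P_h$ an $A$-combination of terms in the multiplicative variables of the head term of $h$ and $g\in\langle\mathcal N(J)\rangle_A$. The marked scheme $\mathbf{Mf}_J$: it represents the functor $A\mapsto\{(\mathcal H)\subset R_A:\mathcal H\text{ is a }\mathcal P_J\text{-marked basis}\}$ on Noetherian $\mathbb K$-algebras. Explicitly $\mathbf{Mf}_J=\mathrm{Spec}(\mathbb K[C]/\mathscr U)$, where $C=\{C_{\alpha\eta}: x^\alpha\in\mathcal P_J,\ x^\eta\in\mathcal N(J),\ |\eta|=|\alpha|\}$, $\mathscr H=\{x^\alpha-\sum_\eta C_{\alpha\eta}x^\eta\}_{x^\alpha\in\mathcal P_J}$, and $\mathscr U$ is generated by the $x$-coefficients of the remainders $g\in\langle\mathcal N(J)\rangle_{\mathbb K[C]}$ in the standard representations of the polynomials $x_ih_\alpha$, with $h_\alpha\in\mathscr H$ and $x_i$ non-multiplicative for $x^\alpha$. A point $p$ with residue field $\kappa(p)$ corresponds to the ideal of $\kappa(p)[x_0,\dots,x_n]$ generated by the specialization of $\mathscr H$ at $p$. A proper ideal in a Noetherian ring is a complete intersection if the minimal number of its generators equals its height. *)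

(* Defs.v *)
From HB Require Import structures.
From mathcomp Require Import all_boot all_order all_algebra.
From mathcomp Require Import generic_quotient ring_quotient fraction finmap.
From mathcomp Require Import boolp.
From mathcomp Require Import mpoly.

Set Implicit Arguments.
Unset Strict Implicit.
Unset Printing Implicit Defensive.

Import GRing.Theory.
Local Open Scope ring_scope.
Local Open Scope quotient_scope.

Section Ideals.
Variable A : comNzRingType.
Implicit Types (I S : A -> Prop) (p : prime_idealr A).

(* Unlike the library's [idealr], the unit ideal is allowed. *)
Definition is_ideal I : Prop :=
  [/\ I 0, forall a b, I a -> I b -> I (a + b) & forall a b, I b -> I (a * b)].

Definition ideal_gen S : A -> Prop :=
  fun a => forall I, is_ideal I -> (forall s, S s -> I s) -> I a.

Fact ideal_gen_ideal S : is_ideal (ideal_gen S).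
Proof.
split=> [I [] //|a b Sa Sb I II IS|a b Sb I II IS]; case: (II) => _ ID IM.
  by apply: ID; [exact: Sa | exact: Sb].
by apply/IM; exact: Sb.
Qed.

(* The descending chain condition for the ideals of A / I, seen as the ideals
   of A that contain I. *)
Definition artinian_quotient I : Prop :=
  forall L : nat -> A -> Prop,
    (forall k, is_ideal (L k)) ->
    (forall k a, I a -> L k a) ->
    (forall k a, L k.+1 a -> L k a) ->
  exists k0, forall k, (k0 <= k)%N -> forall a, L k a <-> L k0 a.

Definition generates (s : seq A) I : Prop :=
  forall a, I a <-> ideal_gen (fun b => b \in s) a.

Definition min_generators I (r : nat) : Prop :=
  (exists2 s, size s = r & generates s I) /\
  (forall s, generates s I -> (r <= size s)%N).

Definition prime_lt p1 p2 : Prop :=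
  {subset p1 <= p2} /\ ~ {subset p2 <= p1}.

Definition prime_chain p (h : nat) : Prop :=
  exists c : nat -> prime_idealr A,
    c h =i p /\ (forall i, (i < h)%N -> prime_lt (c i) (c i.+1)).

Definition prime_height p (h : nat) : Prop :=
  prime_chain p h /\ (forall k, prime_chain p k -> (k <= h)%N).

Definition prime_over I p : Prop := forall a, I a -> a \in p.

Definition ideal_height I (h : nat) : Prop :=
  (exists2 p, prime_over I p & prime_height p h) /\
  (forall p k, prime_over I p -> prime_height p k -> (h <= k)%N).

Definition complete_intersection I : Prop :=
  ~ I 1 /\ exists2 r, min_generators I r & ideal_height I r.

(* [prime_idealr A] is the underlying set of Spec A, and the open sets of the
   Zariski topology are the complements of the closed sets V(E). *)
Definition zariski_closed (Z : prime_idealr A -> Prop) : Prop :=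
  exists E : A -> Prop, forall p, Z p <-> prime_over E p.

Definition zariski_open (U : prime_idealr A -> Prop) : Prop :=
  zariski_closed (fun p => ~ U p).

End Ideals.

(* The library gives A / p only its commutative ring structure; it is made an
   integral domain here, so that its fraction field can be formed. *)
Section ResidueField.
Variables (A : comNzRingType) (p : prime_idealr A).

Definition prime_quot := {ideal_quot p}.
HB.instance Definition _ := GRing.ComNzRing.on prime_quot.

Definition prime_quot_unit : pred prime_quot :=
  fun x => `[< exists y, y * x = 1 >].

Definition prime_quot_inv (x : prime_quot) : prime_quot :=
  if pselect (exists y, y * x = 1) is left xu then projT1 (cid xu) else x.

Fact prime_quot_mulVx : {in prime_quot_unit, left_inverse 1 prime_quot_inv *%R}.
Proof.
move=> x /asboolP xu; rewrite /prime_quot_inv.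
by case: pselect => // xu'; case: (cid xu').
Qed.

Fact prime_quot_unitPl (x y : prime_quot) : y * x = 1 -> prime_quot_unit x.
Proof. by move=> yx1; apply/asboolP; exists y. Qed.

Fact prime_quot_invx_out :
  {in [predC prime_quot_unit], prime_quot_inv =1 id}.
Proof.
move=> x; rewrite inE /= => /asboolP xu; rewrite /prime_quot_inv.
by case: pselect.
Qed.

HB.instance Definition _ := GRing.ComNzRing_hasMulInverse.Build prime_quot
  prime_quot_mulVx prime_quot_unitPl prime_quot_invx_out.

Fact prime_quot_domain (x y : prime_quot) :
  x * y = 0 -> (x == 0) || (y == 0).
Proof. exact: Quotient.rquot_IdomainAxiom. Qed.

HB.instance Definition _ :=
  GRing.ComUnitRing_isIntegral.Build prime_quot prime_quot_domain.

Definition residue_field : fieldType := {fraction prime_quot}.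

Definition residue_map : A -> residue_field :=
  @FracField.tofrac prime_quot \o \pi_{ideal_quot p}.

Fact residue_map_zmod : zmod_morphism residue_map.
Proof. by move=> a b; rewrite /residue_map /= !rmorphB. Qed.

Fact residue_map_monoid : monoid_morphism residue_map.
Proof.
split=> [|a b]; first by rewrite /residue_map /= !rmorph1.
by rewrite /residue_map /= !rmorphM.
Qed.

HB.instance Definition _ :=
  GRing.isZmodMorphism.Build A residue_field residue_map residue_map_zmod.
HB.instance Definition _ :=
  GRing.isMonoidMorphism.Build A residue_field residue_map residue_map_monoid.

End ResidueField.

Section QuotientRing.
Variables (A : comNzRingType) (I : A -> Prop).
Hypotheses (idealI : is_ideal I) (properI : ~ I 1).

Definition ideal_mem of is_ideal I & ~ I 1 : {pred A} := fun a => `[< I a >].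

Fact ideal_mem_closed : idealr_closed (ideal_mem idealI properI).
Proof.
case: (idealI) => I0 ID IM; split; first exact/asboolP.
  exact/asboolP.
by move=> a u v /asboolP Iu /asboolP Iv; apply/asboolP/ID/Iv/IM.
Qed.

HB.instance Definition _ :=
  isIdealr.Build A (ideal_mem idealI properI) ideal_mem_closed.

Definition quotient_ring : comNzRingType :=
  {ideal_quot (ideal_mem idealI properI)}.

Definition quotient_map : {rmorphism A -> quotient_ring} :=
  \pi_{ideal_quot (ideal_mem idealI properI)}.

End QuotientRing.

(* A term x^m is represented by its exponent m : 'X_{1..n.+1}, and the order
   x_0 < ... < x_n of the variables is the order of 'I_n.+1. *)
Section Terms.
Variables (n : nat).
Implicit Types (i j : 'I_n.+1) (a d m : 'X_{1..n.+1}).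

(* x_i <= min(x^m) *)
Definition multiplicative i m : Prop := forall j, (0 < m j)%N -> (i <= j)%N.

(* max(x^d) <= min(x^m) *)
Definition multiplicative_term d m : Prop :=
  forall i, (0 < d i)%N -> multiplicative i m.

Definition terms (A : comNzRingType) (S : 'X_{1..n.+1} -> Prop) :
  {mpoly A[n.+1]} -> Prop := fun f => exists2 m, S m & f = 'X_[m].

(* g is the remainder in a standard representation of f; H gives the marked
   polynomials, indexed by their head terms in P, and N the remaining terms. *)
Definition standard_remainder (A : comNzRingType) (P : {fset 'X_{1..n.+1}})
    (N : 'X_{1..n.+1} -> Prop) (H : 'X_{1..n.+1} -> {mpoly A[n.+1]})
    (f g : {mpoly A[n.+1]}) : Prop :=
  exists q : 'X_{1..n.+1} -> {mpoly A[n.+1]},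
    [/\ forall a d, a \in P -> d \in msupp (q a) -> multiplicative_term d a,
        forall m, m \in msupp g -> N m
      & f = \sum_(a <- P) q a * H a + g].

End Terms.

Section MarkedScheme.
Variables (K : fieldType) (n : nat) (J : {mpoly K[n.+1]} -> Prop).
Variable P : {fset 'X_{1..n.+1}}.
Implicit Types (a d e m s t : 'X_{1..n.+1}).

Definition monomial_ideal : Prop :=
  exists S : 'X_{1..n.+1} -> Prop, forall f, J f <-> ideal_gen (terms S) f.

Definition pommaret_basis : Prop :=
  (forall f, J f <-> ideal_gen (terms (fun m => m \in P)) f) /\
  (forall t, J 'X_[t] -> t \notin P ->
     exists! s, s \in P /\
       exists2 d, t = (d + s)%MM & multiplicative_term d s).

Definition nonmember m : Prop := ~ J 'X_[m].

Definition tails a : seq 'X_{1..n.+1} :=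
  [seq m <- [seq bmnm b | b : 'X_{1..n.+1 < (mdeg a).+1}]
  | (mdeg m == mdeg a) && `[< nonmember m >]].

(* The index pairs (a, e) of the variables C_{a e}; K[C] is then the polynomial
   ring whose k-th variable is the one with the k-th index. *)
Definition coef_index : seq ('X_{1..n.+1} * 'X_{1..n.+1}) :=
  [seq (a, e) | a <- P, e <- tails a].

Definition coef_at (k : 'I_(size coef_index)) := tnth (in_tuple coef_index) k.

Local Notation coef_ring := {mpoly K[size coef_index]}.

Definition generic_marked a : {mpoly coef_ring[n.+1]} :=
  'X_[a] - \sum_(k | (coef_at k).1 == a)
             ('X_k : coef_ring) *: 'X_[(coef_at k).2].

Definition remainder_coef (c : coef_ring) : Prop :=
  exists i a g m,
    [/\ a \in P, ~ multiplicative i a,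
        standard_remainder P nonmember generic_marked
          ('X_i * generic_marked a) g
      & c = g@_m].

Definition marked_relations : coef_ring -> Prop := ideal_gen remainder_coef.

Fact pommaret_basis_ideal : pommaret_basis -> is_ideal J.
Proof.
case=> JE _; have -> : J = ideal_gen (terms (fun m => m \in P)).
  by apply/funext => f; apply/propext.
exact: ideal_gen_ideal.
Qed.

Fact pommaret_basis_msupp f m :
  pommaret_basis -> J f -> m \in msupp f -> J 'X_[m].
Proof.
move=> PB; have [_ _ JM] := pommaret_basis_ideal PB; case: PB => JE _.
move=> /JE /(_ (fun f => forall m, m \in msupp f -> J 'X_[m])); apply.
  split=> [m'|a b Ja Jb m' /msuppD_le|a b Jb m' /msuppM_le].
  - by rewrite msupp0.
  - by rewrite mem_cat => /orP[/Ja|/Jb].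
  - by case/allpairsP=> -[u v] /= [_ /Jb Jv ->]; rewrite mpolyXD; exact: JM.
move=> _ [s sP ->] m'; rewrite msuppX inE => /eqP ->.
by apply/JE => I _; apply; exists s.
Qed.

(* Specialized at the origin C = 0 the generic marked set is the set of terms
   P itself, so that all its remainders vanish there. *)
Fact generic_marked_origin a :
  map_mpoly (meval (fun=> 0)) (generic_marked a) = 'X_[a] :> {mpoly K[n.+1]}.
Proof.
rewrite /generic_marked rmorphB /= map_mpolyX rmorph_sum big1 ?subr0 //= => k _.
by rewrite map_mpolyZ /= mevalXU scale0r.
Qed.

Fact remainder_coef_origin c :
  pommaret_basis -> remainder_coef c -> meval (fun=> 0) c = 0.
Proof.
move=> PB [i [a [g [m [aP _ [q [_ gN qE]] ->]]]]].
have [_ JD JM] := pommaret_basis_ideal PB.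
have JX s : s \in P -> J 'X_[s].
  by move=> sP; case: PB => JE _; apply/JE => I _; apply; exists s.
pose g0 : {mpoly K[n.+1]} := map_mpoly (meval (fun=> 0)) g.
have Jg0 : J g0.
  have := congr1 (map_mpoly (meval (fun=> 0))) qE.
  rewrite rmorphM /= generic_marked_origin rmorphD rmorph_sum -/g0 => g0E.
  have -> : g0 = map_mpoly (meval (fun=> 0)) ('X_i : {mpoly coef_ring[n.+1]})
      * 'X_[a] + (-1) * \sum_(b <- P)
        map_mpoly (meval (fun=> 0)) (q b * generic_marked b).
    by rewrite g0E mulN1r addrC addKr.
  apply: (JD); first exact/JM/JX.
  apply: (JM); rewrite big_seq; apply: (big_ind J); first by case: (pommaret_basis_ideal PB).
    exact: JD.
  by move=> b bP; rewrite rmorphM /= generic_marked_origin; exact/JM/JX.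
have <- : g0@_m = meval (fun=> 0) g@_m by rewrite mcoeff_map_mpoly.
apply/eqP; case: eqVneq => // gm0.
have /gN[] : m \in msupp g.
  rewrite mcoeff_msupp; apply: contra_neq gm0 => gm0.
  by rewrite mcoeff_map_mpoly /= gm0 meval0.
by apply: (pommaret_basis_msupp PB Jg0); rewrite mcoeff_msupp.
Qed.

Fact marked_relations_ideal : is_ideal marked_relations.
Proof. exact: ideal_gen_ideal. Qed.

Fact marked_relations_proper : pommaret_basis -> ~ marked_relations 1.
Proof.
move=> PB U1; suff /eqP : meval (fun=> 0) (1 : coef_ring) = 0 :> K.
  by rewrite meval1 oner_eq0.
apply: (U1 (fun c => meval (fun=> 0) c = 0)).
  split=> [|a b a0 b0|a b b0]; first exact: meval0.
    by rewrite mevalD a0 b0 addr0.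
  by rewrite mevalM b0 mulr0.
by move=> c; exact: remainder_coef_origin.
Qed.

(* The marked scheme is Spec of this ring. *)
Definition marked_ring (PB : pommaret_basis) : comNzRingType :=
  quotient_ring marked_relations_ideal (marked_relations_proper PB).

Definition marked_ring_map (PB : pommaret_basis) :
    {rmorphism coef_ring -> marked_ring PB} :=
  quotient_map marked_relations_ideal (marked_relations_proper PB).

Definition point_ideal (PB : pommaret_basis)
    (p : prime_idealr (marked_ring PB)) : {mpoly (residue_field p)[n.+1]} -> Prop :=
  ideal_gen (fun f => exists2 a, a \in P &
    f = map_mpoly (residue_map p \o marked_ring_map PB) (generic_marked a)).

Definition ci_locus (PB : pommaret_basis)
    (p : prime_idealr (marked_ring PB)) : Prop :=
  complete_intersection (@point_ideal PB p).

End MarkedScheme.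

(* Main.v *)
(* For a marked set, multipliers rewrite downwards in the lexicographic order
   in which the largest variable is the most significant.  Hence standard
   representations exist over every ring, and at every point p of the marked
   scheme the products x^d h_a with x^d multiplicative for x^a form a basis of
   the ideal I_p.  Write x_i h_a, for x_i non-multiplicative, as a combination
   of the h_b; the constant terms of the multipliers are the rows of a matrix
   Theta over the coordinate ring of the scheme.  By the same rewriting, the
   constant terms of any syzygy of the h_a at p lie in the row space of
   Theta(p), so that, by a graded Nakayama argument, the minimal number of
   generators of I_p is |P| - rank Theta(p).  As I_p contains a power of every
   variable, it is the unit ideal, or it has height n + 1 and needs at least
   n + 1 generators; both dimension bounds follow from counting monomials.
   So the complete intersection locus is empty if 1 is in P, and otherwise it
   is the open set where rank Theta(p) >= |P| - (n + 1). *)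
Require Import Defs.
From HB Require Import structures.
From mathcomp Require Import all_boot all_order all_algebra.
From mathcomp Require Import ring_quotient fraction boolp finmap mpoly.
From mathcomp Require Import zify.

Set Implicit Arguments.
Unset Strict Implicit.
Unset Printing Implicit Defensive.

Import GRing.Theory.
Local Open Scope ring_scope.

(** * Lexicographic order and Pommaret cones *)

Section Lex.
Variable n : nat.
Implicit Types d e c m : 'X_{1..n}.

Definition lex_lt d e : Prop :=
  exists2 k : 'I_n, (d k < e k)%N & forall j : 'I_n, (k < j)%N -> d j = e j.

Lemma lex_ltD2l c d e : lex_lt d e -> lex_lt (c + d)%MM (c + e)%MM.
Proof.
case=> k dek eqj; exists k => [|j kj]; rewrite !mnmDE.
  by rewrite ltn_add2l.
by rewrite eqj.
Qed.

Lemma lex_lt_trans d e c : lex_lt d e -> lex_lt e c -> lex_lt d c.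
Proof.
move=> [k dek eqk] [l ecl eql]; case: (ltngtP k l) => [kl|lk|/val_inj kl].
- exists l => [|j lj]; first by rewrite eqk.
  by rewrite eqk ?eql // (ltn_trans kl).
- exists k => [|j kj]; first by rewrite -eql.
  by rewrite eqk // eql // (ltn_trans lk).
- subst l; exists k => [|j kj]; first exact: ltn_trans dek ecl.
  by rewrite eqk // eql.
Qed.

Lemma lex_lt_total d e : [\/ lex_lt d e, d = e | lex_lt e d].
Proof.
have [/eqfunP de|] := boolP [forall i, d i == e i].
  by constructor 2; apply/mnmP.
rewrite negb_forall => /existsP[i0 i0P].
case: (@arg_maxnP _ i0 (fun i => d i != e i) (fun i => i) i0P) => k /= kP kmax.
have eqj (j : 'I_n) : (k < j)%N -> d j = e j.
  by move=> kj; apply: contraTeq kj => /kmax; rewrite -leqNgt.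
case: (ltngtP (d k) (e k)) kP => // dek _; first by constructor 1; exists k.
by constructor 3; exists k => // j /eqj.
Qed.

(** Well-foundedness of the lexicographic order. The coordinates below [k] are freed one at a time,
    and each step needs an inner induction on a bound for coordinate [k]. *)
Lemma lex_lt_ind (Q : 'X_{1..n} -> Prop) :
  (forall e, (forall d, lex_lt d e -> Q d) -> Q e) -> forall e, Q e.
Proof.
move=> IQ.
pose agree (k : nat) d e := forall j : 'I_n, (k <= j)%N -> d j = e j.
pose below (k : nat) d e := exists2 l : 'I_n, (k <= l)%N /\ (d l < e l)%N &
   forall j : 'I_n, (l < j)%N -> d j = e j.
have H k : (k <= n)%N -> forall e, (forall d, below k d e -> Q d) ->
    forall d, agree k d e -> Q d.
  elim: k => [|k IHk] kn e ltQ.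
    move=> d ae; have -> : d = e by apply/mnmP => j; exact: ae.
    by apply: IQ => c [l cel eqj]; apply: ltQ; exists l.
  pose k0 := Ordinal kn.
  suff H r d : (d k0 < r)%N -> agree k.+1 d e -> Q d by move=> d; exact: H.
  elim: r d => // r IHr d dr ade; apply: (IHk (ltnW kn) d) => // c.
  case=> l [kl cdl] eqj; have [kEl|kNl] := eqVneq (l : nat) k.
    have lk : l = k0 by apply: val_inj.
    apply: IHr => [|j kj]; first by rewrite -lk (leq_trans cdl) // lk -ltnS.
    by rewrite eqj ?kEl // ade.
  have {}kl : (k < l)%N by rewrite ltn_neqAle eq_sym kNl.
  apply: ltQ; exists l; first by rewrite -ade.
  by move=> j lj; rewrite eqj // ade // (leq_trans kl) // ltnW.
by move=> e; apply: (H n _ e) => // d [l []]; rewrite leqNgt ltn_ord.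
Qed.

Lemma lex_maximal (s : seq 'X_{1..n}) :
  s != [::] -> exists2 e, e \in s & forall d, d \in s -> ~ lex_lt e d.
Proof.
have irr e : ~ lex_lt e e by case=> k; rewrite ltnn.
elim: s => // c s IHs _; have [->|/IHs[e es emax]] := eqVneq s [::].
  by exists c => [|d]; rewrite ?mem_head // inE => /eqP -> /irr.
case: (lex_lt_total c e) => [ce|ce|ec].
- exists e => [|d]; rewrite inE ?es ?orbT // => /orP[/eqP ->|/emax //].
  by move=> /lex_lt_trans/(_ ce)/irr.
- exists e => [|d]; rewrite inE ?es ?orbT // => /orP[/eqP ->|/emax //].
  by rewrite ce => /irr.
- exists c => [|d]; rewrite inE ?eqxx // => /orP[/eqP -> /irr //|/emax ed cd].
  exact/ed/(lex_lt_trans ec).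
Qed.

End Lex.

(** * Generated ideals as sets of linear combinations *)

Section Ideals.
Variable A : comNzRingType.
Implicit Types (I S : A -> Prop).

Lemma mem_ideal_gen S a : S a -> ideal_gen S a.
Proof. by move=> Sa I _ SI; exact: SI. Qed.

Lemma ideal_gen_min S I : is_ideal I -> (forall a, S a -> I a) ->
  forall a, ideal_gen S a -> I a.
Proof. by move=> iI SI a Sa; exact: Sa. Qed.

Lemma ideal_sum I (T : Type) (r : seq T) (Q : pred T) (F : T -> A) :
  is_ideal I -> (forall t, Q t -> I (F t)) -> I (\sum_(t <- r | Q t) F t).
Proof. by case=> I0 ID _ IF; apply: (big_ind I). Qed.

Lemma idealN I a : is_ideal I -> I a -> I (- a).
Proof. by case=> _ _ IM Ia; rewrite -mulN1r; exact: IM. Qed.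

Lemma idealB I a b : is_ideal I -> I a -> I b -> I (a - b).
Proof.
by move=> iI Ia Ib; case: (iI) => _ ID _; apply: ID => //; exact: idealN.
Qed.

Lemma ideal_gen_finP (T : finType) (F : T -> A) a :
  ideal_gen (fun x => exists t, x = F t) a <->
  exists c : T -> A, a = \sum_t c t * F t.
Proof.
split=> [|[c ->]]; last first.
  apply: ideal_sum; first exact: ideal_gen_ideal.
  move=> t _; have [_ _ IM] := ideal_gen_ideal (fun x => exists t, x = F t).
  by apply: IM; apply: mem_ideal_gen; exists t.
apply: (ideal_gen_min
  (I := fun x => exists c : T -> A, x = \sum_t c t * F t)) => [|_ [t ->]].
  split=> [|x y [c ->] [c' ->]|x y [c ->]].
  - by exists (fun=> 0); rewrite big1 // => t _; rewrite mul0r.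
  - exists (fun t => c t + c' t); rewrite -big_split /=.
    by apply: eq_bigr => t _; rewrite mulrDl.
  - exists (fun t => x * c t); rewrite mulr_sumr.
    by apply: eq_bigr => t _; rewrite mulrA.
exists (fun u => (u == t)%:R); rewrite (bigD1 t) //= eqxx mul1r big1 ?addr0 //.
by move=> u /negPf ->; rewrite mul0r.
Qed.

Lemma ideal_gen_seqP (s : seq A) a :
  ideal_gen (fun x => x \in s) a <->
  exists c : 'I_(size s) -> A, a = \sum_t c t * tnth (in_tuple s) t.
Proof.
rewrite -ideal_gen_finP (_ : (fun x => x \in s : Prop) =
  (fun x => exists t, x = tnth (in_tuple s) t)) //.
apply/funext => x; apply/propext; split=> [/seq_tnthP[t ->]|[t ->]].
  by exists t.
exact: mem_tnth.
Qed.

End Ideals.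

Section Cones.
Variables (n N : nat).
Implicit Types (d e c m t : 'X_{1..n.+1}) (i : 'I_n.+1).

Variables (J : 'X_{1..n.+1} -> Prop) (b : 'I_N -> 'X_{1..n.+1}).

(** Disjointness only equates the indices: [d = e] then follows by cancelling [b k]. *)
Definition cone_partition : Prop :=
  [/\ forall k, J (b k), forall m d, J m -> J (d + m)%MM,
      forall m, J m -> exists k d,
        m = (d + b k)%MM /\ multiplicative_term d (b k)
    & forall k l d e, (d + b k = e + b l)%MM -> multiplicative_term d (b k) ->
        multiplicative_term e (b l) -> k = l].

Lemma multiplicative_term0 m : multiplicative_term 0%MM m.
Proof. by move=> i; rewrite mnm0E. Qed.

(* The largest index at which d and d' differ is at most min(m'); above it, m
   and m' agree, below it m' vanishes. *)
Lemma lex_cone d m d' m' :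
  (d + m = d' + m')%MM -> multiplicative_term d' m' -> lex_lt d d' ->
  exists2 c, m = (c + m')%MM & c != 0%MM /\ multiplicative_term c m'.
Proof.
move=> /mnmP E d'M [k dk eqj].
have Ej j := E j; have mk : Defs.multiplicative k m' by apply: d'M; lia.
have m'0 (j : 'I_n.+1) : (j < k)%N -> m' j = 0%N.
  by case: (posnP (m' j)) => // /mk; lia.
have le j : (m' j <= m j)%N.
  case: (ltngtP j k) => [/m'0 -> //|/eqj jk|/val_inj ->].
    by move: (Ej j); rewrite !mnmDE; lia.
  by move: (Ej k); rewrite !mnmDE; lia.
exists (m - m')%MM; first by rewrite submK //; apply/mnm_lepP.
split=> [|j].
  apply/eqP => /mnmP /(_ k); rewrite mnmBE mnm0E.
  by move: (Ej k); rewrite !mnmDE; lia.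
rewrite mnmBE => mj l /mk kl; apply: leq_trans kl.
rewrite leqNgt; apply/negP => /eqj jk.
by move: (Ej j); rewrite !mnmDE; lia.
Qed.

Hypothesis conesJ : cone_partition.

(** By [lex_cone], a multiplier [c] above [d] would make [m] a multiple of [b k], and [c = d] would
    give [m = b k]; both put [m] in [J]. *)
Lemma reduce_normal d m : ~ J m -> J (d + m)%MM -> exists k c,
  [/\ (d + m = c + b k)%MM, multiplicative_term c (b k) & lex_lt c d].
Proof.
case: conesJ => Jb JM cover _ Jm /cover[k [c [E cM]]]; exists k, c; split=> //.
case: (lex_lt_total c d) => // [cd|/(lex_cone E cM)[c' mE _]]; case: Jm.
  by move: E; rewrite cd => /addmI ->; exact: Jb.
by rewrite mE; exact/JM/Jb.
Qed.

(** If [c] were above [U_(i)], then [b l] would lie in the cone of [b k] with a nonzero multiplier,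
    against disjointness. If [c] were [U_(i)], then [b l = b k] and [i] would be multiplicative. *)
Lemma reduce_head i l : ~ Defs.multiplicative i (b l) -> exists k c,
  [/\ (U_(i) + b l = c + b k)%MM, multiplicative_term c (b k)
    & lex_lt c U_(i)%MM].
Proof.
case: conesJ => Jb JM cover disj iM.
have [k [c [E cM]]] := cover _ (JM _ U_(i)%MM (Jb l)); exists k, c; split=> //.
case: (lex_lt_total c U_(i)%MM) => // [cd|/(lex_cone E cM)[c' bE [c'0 c'M]]].
  move: E; rewrite cd => /addmI bE; case: iM; rewrite bE.
  by apply: cM; rewrite cd mnm1E eqxx.
have kl : l = k.
  apply: (disj _ _ 0%MM c') => //; first by rewrite add0m.
  exact: multiplicative_term0.
by move/eqP: c'0; case; apply: (@addIm _ (b k)); rewrite -bE add0m kl.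
Qed.

End Cones.

(** * Standard representations *)

Lemma mpoly_comb_ind n (A : nzRingType) (Q : {mpoly A[n]} -> Prop) f :
  Q 0 -> (forall u v, Q u -> Q v -> Q (u + v)) ->
  (forall c m, m \in msupp f -> Q (c *: 'X_[m])) -> Q f.
Proof.
move=> Q0 QD QX; rewrite (mpolyE f) big_seq.
by apply: (big_ind Q) => // m; exact: QX.
Qed.

Section Marked.
Variables (n N : nat) (A : comNzRingType).
Variables (J : 'X_{1..n.+1} -> Prop) (b : 'I_N -> 'X_{1..n.+1}).
Variable h : 'I_N -> {mpoly A[n.+1]}.
Implicit Types (d e c m t : 'X_{1..n.+1}) (i : 'I_n.+1) (k l : 'I_N).
Implicit Types (L : 'X_{1..n.+1} -> Prop) (f g u v : {mpoly A[n.+1]}).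

Definition marked_set : Prop := forall k m, m \in msupp ('X_[b k] - h k) ->
  ~ J m /\ mdeg m = mdeg (b k).

(* A homogeneous standard representation of degree D in which L restricts the
   multipliers of the marked polynomials. *)
Definition std_rep L (D : nat) f : Prop :=
  exists (q : 'I_N -> {mpoly A[n.+1]}) g,
  [/\ forall k c, c \in msupp (q k) ->
        [/\ multiplicative_term c (b k), L c & (mdeg c + mdeg (b k) = D)%N],
      forall m, m \in msupp g -> ~ J m /\ mdeg m = D
    & f = \sum_k q k * h k + g].

Lemma std_rep0 L D : std_rep L D 0.
Proof.
exists (fun=> 0), 0; split=> [k c|m|]; rewrite ?msupp0 // addr0 big1 //.
by move=> k _; rewrite mul0r.
Qed.

Lemma std_repD L D u v : std_rep L D u -> std_rep L D v -> std_rep L D (u + v).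
Proof.
move=> [q [g [qP gP ->]]] [q' [g' [qP' gP' ->]]].
exists (fun k => q k + q' k), (g + g'); split=> [k c /msuppD_le|m /msuppD_le|].
- by rewrite mem_cat => /orP[/qP|/qP'].
- by rewrite mem_cat => /orP[/gP|/gP'].
- rewrite addrACA -big_split /=; congr (_ + _).
  by apply: eq_bigr => k _; rewrite mulrDl.
Qed.

Lemma std_repZ L D a u : std_rep L D u -> std_rep L D (a *: u).
Proof.
move=> [q [g [qP gP ->]]]; exists (fun k => a *: q k), (a *: g).
split=> [k c /msuppZ_le/qP|m /msuppZ_le/gP|] //.
rewrite scalerDr scaler_sumr; congr (_ + _).
by apply: eq_bigr => k _; rewrite -scalerAl.
Qed.

Lemma std_repW L L' D u :
  (forall c, L c -> L' c) -> std_rep L D u -> std_rep L' D u.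
Proof.
move=> LL' [q [g [qP gP uE]]]; exists q, g; split=> // k c /qP[cM Lc cD].
by split=> //; exact: LL'.
Qed.

Lemma std_rep_normal L D m : ~ J m -> mdeg m = D -> std_rep L D 'X_[m].
Proof.
move=> Nm mD; exists (fun=> 0), 'X_[m]; split=> [k c|c|].
- by rewrite msupp0.
- by rewrite msuppX inE => /eqP ->.
- by rewrite big1 ?add0r // => k _; rewrite mul0r.
Qed.

Lemma std_rep_cone L c k : multiplicative_term c (b k) -> L c ->
  std_rep L (mdeg c + mdeg (b k)) ('X_[c] * h k).
Proof.
move=> cM Lc; exists (fun l => if l == k then 'X_[c] else 0), 0.
split=> [l d|m|]; last 2 first.
- by rewrite msupp0.
- rewrite addr0 (bigD1 k) //= eqxx big1 ?addr0 //.
  by move=> l /negPf ->; rewrite mul0r.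
by case: eqP => [->|_]; rewrite ?msupp0 // msuppX inE => /eqP ->.
Qed.

Hypotheses (conesJ : cone_partition J b) (markedh : marked_set).

(** Lexicographic induction on [d]. A term [d + m] in [J] lies in a cone with multiplier [c] below
    [d]; replacing the head [b k] by [h k] plus its tail leaves [c] times normal terms, to which the
    induction applies. *)
Lemma std_repMX_normal d m : ~ J m ->
  std_rep (fun x => lex_lt x d) (mdeg d + mdeg m) 'X_[d + m].
Proof.
move: d m; apply: (@lex_lt_ind _ (fun d => forall m, ~ J m ->
  std_rep (fun x => lex_lt x d) (mdeg d + mdeg m) 'X_[d + m])) => d IH m Nm.
have [Jdm|Ndm] := pselect (J (d + m)%MM); last first.
  by apply: std_rep_normal; rewrite ?mdegD.
have [k [c [E cM cd]]] := reduce_normal conesJ Nm Jdm.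
rewrite -mdegD E mdegD mpolyXD -[X in _ * X](subrK (h k)) mulrDr addrC.
apply: std_repD; first exact: std_rep_cone.
apply: std_repW (fun e ec => lex_lt_trans ec cd) _.
apply: (@mpoly_comb_ind _ _ (fun u => std_rep _ _ ('X_[c] * u))).
- by rewrite mulr0; exact: std_rep0.
- by move=> u v; rewrite mulrDr; exact: std_repD.
- move=> a e /markedh[Ne <-]; rewrite -scalerAr -mpolyXD.
  exact/std_repZ/IH.
Qed.

Lemma std_repMX d D f : (forall m, m \in msupp f -> ~ J m /\ mdeg m = D) ->
  std_rep (fun x => lex_lt x d) (mdeg d + D) ('X_[d] * f).
Proof.
move=> fP; apply: (@mpoly_comb_ind _ _ (fun u => std_rep _ _ ('X_[d] * u))).
- by rewrite mulr0; exact: std_rep0.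
- by move=> u v; rewrite mulrDr; exact: std_repD.
- move=> a e /fP[Ne <-]; rewrite -scalerAr -mpolyXD.
  exact/std_repZ/std_repMX_normal.
Qed.

(** Because [U_(i) + b l = c + b k], the heads of ['X_i * h l] and ['X_[c] * h k] cancel. What
    remains are tails multiplied by ['X_i] and ['X_[c]], whose reductions only use multipliers below
    [U_(i)]. *)
Lemma std_repM_head i l : ~ Defs.multiplicative i (b l) ->
  std_rep (fun x => lex_lt x U_(i)%MM) (1 + mdeg (b l)) ('X_i * h l).
Proof.
move=> /(reduce_head conesJ)[k [c [E cM ci]]].
have deg_c : (mdeg c + mdeg (b k) = 1 + mdeg (b l))%N.
  by rewrite -mdegD -E mdegD mdeg1.
have -> : 'X_i * h l = 'X_[c] * h k + 'X_[c] * ('X_[b k] - h k)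
    + (-1) *: ('X_i * ('X_[b l] - h l)).
  rewrite scaleN1r !mulrBr -!mpolyXD E.
  by rewrite opprB !subrKC.
apply: std_repD; first apply: std_repD.
- by rewrite -deg_c; exact: std_rep_cone.
- rewrite -deg_c; apply: std_repW (fun e ec => lex_lt_trans ec ci) _.
  exact/std_repMX/markedh.
- by rewrite -[1%N](mdeg1 i); apply/std_repZ/std_repMX/markedh.
Qed.

Lemma std_rep_mpolyX m : std_rep (fun=> True) (mdeg m) 'X_[m].
Proof.
have [Jm|Nm] := pselect (J m); last exact: std_rep_normal.
case: conesJ => _ _ /(_ _ Jm)[k [c [-> cM]]] _.
rewrite mdegD mpolyXD -[X in _ * X](subrK (h k)) mulrDr addrC.
apply: std_repD; first exact: std_rep_cone.
by apply: (std_repW (L := fun x => lex_lt x c)) => //; exact/std_repMX/markedh.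
Qed.

(* Compare coefficients at the heads of the lex-largest multipliers: the other
   heads are different, and the tails only meet cones of smaller multipliers. *)
Lemma std_rep_unique (q : 'I_N -> {mpoly A[n.+1]}) :
  (forall k c, c \in msupp (q k) -> multiplicative_term c (b k)) ->
  \sum_k q k * h k = 0 -> forall k, q k = 0.
Proof.
move=> qM sum0; pose s := flatten [seq msupp (q k) | k : 'I_N].
have [s0 k|/lex_maximal[c /flattenP[_ /imageP[k _ ->] cq] cmax]] :=
  eqVneq s [::].
  apply: msuppnil0; case E: (msupp (q k)) => [//|c r].
  suff : c \in s by rewrite s0.
  by apply/flattenP; exists (msupp (q k)); rewrite ?image_f // E mem_head.
have [Jb JM _ disj] := conesJ; have Jc := JM _ c (Jb k).
have tail0 l : (q l * ('X_[b l] - h l))@_(c + b k) = 0.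
  apply: memN_msupp_eq0; apply/negP => /msuppM_le/allpairsP[[d m]] /= [dq].
  move=> /markedh[Nm _] E; have Jdm : J (d + m)%MM by rewrite -E.
  have [k' [c' [E' c'M c'd]]] := reduce_normal conesJ Nm Jdm.
  rewrite E' in E; have kk' := disj _ _ _ _ E (qM _ _ cq) c'M.
  move: E; rewrite -kk' => /addIm cc'; apply: (cmax d); last by rewrite cc'.
  by apply/flattenP; exists (msupp (q l)); rewrite ?image_f.
have head0 l : l != k -> (q l * 'X_[b l])@_(c + b k) = 0.
  move=> lk; apply: memN_msupp_eq0; apply: contra lk.
  move=> /msuppM_le/allpairsP[[d m]] /= [dq]; rewrite msuppX inE => /eqP ->.
  by move=> E; apply/eqP/(disj _ _ _ _ (esym E)); [exact: qM dq | exact: qM cq].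
have hE l : q l * h l = q l * 'X_[b l] - q l * ('X_[b l] - h l).
  by rewrite -mulrBr subKr.
move/(congr1 (mcoeff (c + b k)%MM)): sum0; rewrite mcoeff0 raddf_sum /=.
rewrite (bigD1 k) //= big1 ?addr0 => [|l lk].
  rewrite hE mcoeffB tail0 subr0 addmC mcoeffMX => /eqP.
  by rewrite mcoeff_eq0 cq.
by rewrite hE mcoeffB tail0 head0 // subr0.
Qed.

End Marked.

(** * Syzygies and the number of generators *)

(** This is Theta. Pairs [(i, k)] with [i] multiplicative also index rows; [rel] is taken to be zero
    there. *)
Definition relation_matrix (n N : nat) (A : nzRingType)
    (rel : 'I_n.+1 -> 'I_N -> 'I_N -> {mpoly A[n.+1]}) :
    'M[A]_(#|{: 'I_n.+1 * 'I_N}|, N) :=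
  \matrix_(r, l) (rel (enum_val r).1 (enum_val r).2 l)@_0.

Section Relations.
Variables (n N : nat) (F : fieldType).
Variables (J : 'X_{1..n.+1} -> Prop) (b : 'I_N -> 'X_{1..n.+1}).
Variable h : 'I_N -> {mpoly F[n.+1]}.
Variable rel : 'I_n.+1 -> 'I_N -> 'I_N -> {mpoly F[n.+1]}.
Implicit Types (d e c m : 'X_{1..n.+1}) (i : 'I_n.+1) (k l : 'I_N).
Implicit Types (f g u : {mpoly F[n.+1]}) (v w : 'rV[F]_N).

Hypotheses (conesJ : cone_partition J b) (markedh : marked_set J b h).

Hypothesis relE : forall i k, ~ Defs.multiplicative i (b k) ->
  'X_i * h k = \sum_l rel i k l * h l.
Hypothesis rel_lt : forall i k l c, c \in msupp (rel i k l) -> lex_lt c U_(i)%MM.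
Hypothesis rel_deg : forall i k l c, c \in msupp (rel i k l) ->
  (mdeg c + mdeg (b l) = 1 + mdeg (b k))%N.
Hypothesis rel_mul : forall i k l, Defs.multiplicative i (b k) -> rel i k l = 0.

Definition marked_ideal : {mpoly F[n.+1]} -> Prop :=
  ideal_gen (fun x => exists k, x = h k).

Local Notation relation_mx := (relation_matrix rel).

Definition const_row (q : 'I_N -> {mpoly F[n.+1]}) : 'rV[F]_N :=
  \row_l (q l)@_0.

Lemma const_row_rel i k : (const_row (rel i k) <= relation_mx)%MS.
Proof.
have -> : const_row (rel i k) = row (enum_rank (i, k)) relation_mx.
  by apply/rowP => l; rewrite !mxE enum_rankK.
exact: row_sub.
Qed.

(* Modulo the row space of the relation matrix, v is the vector of constant terms
   of a multiplicative representation of f. *)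
Definition rewrites f v : Prop := exists q : 'I_N -> {mpoly F[n.+1]},
  [/\ forall k c, c \in msupp (q k) -> multiplicative_term c (b k),
      f = \sum_k q k * h k & (const_row q - v <= relation_mx)%MS].

Lemma rewrites0 : rewrites 0 0.
Proof.
exists (fun=> 0); split=> [k c||]; first by rewrite msupp0.
  by rewrite big1 // => k _; rewrite mul0r.
rewrite subr0 (_ : const_row _ = 0) ?sub0mx //.
by apply/rowP => k; rewrite !mxE mcoeff0.
Qed.

Lemma rewritesD f g v w :
  rewrites f v -> rewrites g w -> rewrites (f + g) (v + w).
Proof.
move=> [q [qM -> qv]] [r [rM -> rw]]; exists (fun k => q k + r k).
split=> [k c /msuppD_le||]; first by rewrite mem_cat => /orP[/qM|/rM].
  by rewrite -big_split; apply: eq_bigr => k _; rewrite mulrDl.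
rewrite (_ : const_row _ - _ = (const_row q - v) + (const_row r - w)).
  exact: addmx_sub.
by rewrite addrACA -opprD; congr (_ - _); apply/rowP => k; rewrite !mxE mcoeffD.
Qed.

Lemma rewritesZ a f v : rewrites f v -> rewrites (a *: f) (a *: v).
Proof.
move=> [q [qM -> qv]]; exists (fun k => a *: q k).
split=> [k c /msuppZ_le/qM||] //.
  by rewrite scaler_sumr; apply: eq_bigr => k _; rewrite scalerAl.
rewrite (_ : const_row _ - _ = a *: (const_row q - v)) ?scalemx_sub //.
by rewrite scalerBr; congr (_ - _); apply/rowP => k; rewrite !mxE mcoeffZ.
Qed.

Lemma rewrites_sum (f : 'I_N -> {mpoly F[n.+1]}) (v : 'I_N -> 'rV[F]_N) :
  (forall k, rewrites (f k) (v k)) -> rewrites (\sum_k f k) (\sum_k v k).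
Proof.
move=> fv; apply: (big_ind2 rewrites) => //; first exact: rewrites0.
by move=> f1 v1 f2 v2; exact: rewritesD.
Qed.

Lemma rewrites_comb u f (v : 'rV[F]_N) (a : {mpoly F[n.+1]}) :
  (forall c, c \in msupp u ->
     rewrites (a * 'X_[c] * f) ((a * 'X_[c])@_0 *: v)) ->
  rewrites (a * u * f) ((a * u)@_0 *: v).
Proof.
move=> uP; apply: (@mpoly_comb_ind _ _
  (fun x => rewrites (a * x * f) ((a * x)@_0 *: v))).
- by rewrite mulr0 mul0r mcoeff0 scale0r; exact: rewrites0.
- move=> x y xP yP; rewrite mulrDr mulrDl mcoeffD scalerDl.
  exact: rewritesD.
- move=> x c /uP/(rewritesZ x).
  by rewrite -scalerAr -scalerAl mcoeffZ scalerA.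
Qed.

Lemma const_rowE (q : 'I_N -> {mpoly F[n.+1]}) :
  const_row q = \sum_k (q k)@_0 *: delta_mx 0 k.
Proof.
rewrite [LHS]row_sum_delta; apply: eq_bigr => k _; by rewrite mxE.
Qed.

(** Lexicographic induction on [e]. If some [i] in [e] is non-multiplicative, the relation for
    ['X_i * h k] replaces [e] by multipliers that [rel_lt] makes smaller. *)
Lemma rewrites_mpolyX e k :
  rewrites ('X_[e] * h k) (('X_[e] : {mpoly F[n.+1]})@_0 *: delta_mx 0 k).
Proof.
move: e k; apply: lex_lt_ind => e IH k.
have [eM|/existsNP[i /not_implyP[ei iM]]] :=
  pselect (multiplicative_term e (b k)).
  exists (fun l => if l == k then 'X_[e] else 0); split=> [l c||].
  - by case: eqP => [->|_]; rewrite ?msupp0 // msuppX inE => /eqP ->.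
  - rewrite (bigD1 k) //= eqxx big1 ?addr0 // => l /negPf ->.
    by rewrite mul0r.
  - rewrite const_rowE (bigD1 k) //= eqxx big1 ?addr0 ?subrr ?sub0mx //.
    by move=> l /negPf ->; rewrite mcoeff0 scale0r.
pose c0 := (e - U_(i))%MM.
have eE : e = (c0 + U_(i))%MM by rewrite submK // lep1mP -lt0n.
have e0 : ('X_[e] : {mpoly F[n.+1]})@_0 = 0.
  rewrite mcoeffX; case: eqP ei => // ->; by rewrite mnm0E.
have : rewrites ('X_[e] * h k) (\sum_l ('X_[c0] * rel i k l)@_0 *: delta_mx 0 l).
  rewrite eE mpolyXD -mulrA relE // mulr_sumr; apply: rewrites_sum => l.
  rewrite mulrA; apply: rewrites_comb => // c /rel_lt ci.
  rewrite -mpolyXD; apply: IH; rewrite eE; exact: lex_ltD2l.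
case=> q [qM qE qv]; exists q; split=> //; rewrite e0 scale0r subr0.
(* The rewriting changes the constant terms by a scalar multiple of a row of Theta, which is nonzero
   only if [e] is the single variable [x_i]. *)
have -> : const_row q = const_row q -
    \sum_l ('X_[c0] * rel i k l)@_0 *: delta_mx 0 l +
    ('X_[c0] : {mpoly F[n.+1]})@_0 *: const_row (rel i k).
  rewrite (const_rowE (rel i k)) scaler_sumr.
  under [X in _ + X]eq_bigr do rewrite scalerA -rmorphM.
  by rewrite subrK.
by rewrite addmx_sub // scalemx_sub // const_row_rel.
Qed.

Lemma rewrites_ideal (q : 'I_N -> {mpoly F[n.+1]}) :
  rewrites (\sum_k q k * h k) (const_row q).
Proof.
rewrite const_rowE; apply: rewrites_sum => k; rewrite -[q k]mul1r.
apply: rewrites_comb => // c _; rewrite mul1r; exact: rewrites_mpolyX.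
Qed.

(** Rewriting the syzygy gives a multiplicative representation of 0, which is trivial by
    [std_rep_unique]; only rows of Theta were added on the way. *)
Lemma const_row_syzygy (q : 'I_N -> {mpoly F[n.+1]}) :
  \sum_k q k * h k = 0 -> (const_row q <= relation_mx)%MS.
Proof.
move=> q0; have [r [rM rE]] := rewrites_ideal q.
have /= r0 := std_rep_unique conesJ markedh rM (etrans (esym rE) q0).
have -> : const_row r = 0 by apply/rowP => k; rewrite !mxE r0 mcoeff0.
by rewrite sub0r eqmx_opp.
Qed.

(** Expressing [s] through the [h k] and back gives constant matrices [U] and [V] such that the rows
    of [1 - V U] come from syzygies. Hence the identity has rank at most [size s] plus the rank of
    Theta. *)
Lemma generates_rank s :
  generates s marked_ideal -> (N <= size s + \rank relation_mx)%N.
Proof.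
move=> sI; pose s_ (t : 'I_(size s)) := tnth (in_tuple s) t.
have /choice[u uE] (t : 'I_(size s)) : exists u : 'I_N -> {mpoly F[n.+1]},
    s_ t = \sum_k u k * h k.
  by apply/ideal_gen_finP/sI; apply: mem_ideal_gen; exact: mem_tnth.
have /choice[v vE] k : exists v : 'I_(size s) -> {mpoly F[n.+1]},
    h k = \sum_t v t * s_ t.
  by apply/ideal_gen_seqP/sI; apply: mem_ideal_gen; exists k.
pose U : 'M[F]_(size s, N) := \matrix_(t, k) (u t k)@_0.
pose V : 'M[F]_(N, size s) := \matrix_(k, t) (v k t)@_0.
have VU : (1%:M - V *m U <= relation_mx)%MS.
  apply/row_subP => k.
  (* The syzygy obtained by writing [h k] through [s] and then [s] through the [h l]. *)
  pose q l := (k == l)%:R - \sum_t v k t * u t l.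
  suff <- : const_row q = row k (1%:M - V *m U).
    apply: const_row_syzygy; rewrite /q.
    under eq_bigr do rewrite mulrBl; rewrite sumrB (bigD1 k) //= eqxx mul1r.
    rewrite big1 ?addr0 => [|l lk]; last by rewrite eq_sym (negPf lk) mul0r.
    rewrite {1}vE; apply/eqP; rewrite subr_eq0; apply/eqP.
    under [RHS]eq_bigr do rewrite mulr_suml; rewrite exchange_big /=.
    apply: eq_bigr => t _; rewrite uE mulr_sumr.
    by apply: eq_bigr => l _; rewrite mulrA.
  apply/rowP => l; rewrite !mxE mcoeffB raddf_sum /= -mpolyC_nat mcoeffC eqxx.
  by rewrite mulr1; congr (_ - _); apply: eq_bigr => t _; rewrite !mxE rmorphM.
have := mxrank_add (V *m U) (1%:M - V *m U); rewrite addrC subrK mxrank1.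
move/leq_trans; apply; apply: leq_add; last exact: mxrankS.
by apply: leq_trans (mxrankM_maxl _ _) _; exact: rank_leq_col.
Qed.

(* The columns outside a maximal set of pivots of the relation matrix give
   generators; the other h k are eliminated by induction on their degree. *)
Lemma rank_generates :
  exists2 s, (size s + \rank relation_mx)%N = N & generates s marked_ideal.
Proof.
(* [f] selects pivot columns, and [Y] is a left inverse of the submatrix they form. *)
pose f := maxrankfun relation_mx^T.
have [Y YE] : exists Y, Y *m colsub f relation_mx = 1%:M.
  have /row_freeP[Y YE] := maxrowsub_free relation_mx^T.
  exists Y^T; apply: trmx_inj; rewrite trmx_mul trmxK trmx1 -YE.
  by congr (_ *m _); apply/matrixP => j r; rewrite !mxE.
pose s := [seq h k | k in [predC codom f]].
have size_s : (size s + \rank relation_mx)%N = N.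
  rewrite size_image addnC -[RHS](card_ord N) -(cardC (mem (codom f))).
  suff -> : #|codom f| = \rank relation_mx by [].
  by rewrite (card_codom (@maxrankfun_inj _ _ _ _)) card_ord mxrank_tr.
exists s => // a; split; last first.
  apply: ideal_gen_min => [|_ /imageP[k _ ->]]; first exact: ideal_gen_ideal.
  by apply: mem_ideal_gen; exists k.
pose I := ideal_gen (fun x => x \in s).
have iI : is_ideal I := ideal_gen_ideal _.
have [I0 ID IM] := iI.
apply: ideal_gen_min => // _ [k ->].
have sI l : l \notin codom f -> I (h l).
  by move=> lf; apply: mem_ideal_gen; exact: image_f.
have [D] := ubnP (mdeg (b k)); elim: D k => // D.
rewrite -/I => IH k; rewrite ltnS => kD.
have [/codomP[j kf]|/sI //] := boolP (k \in codom f).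
pose deg (r : 'I_#|{: 'I_n.+1 * 'I_N}|) := (1 + mdeg (b (enum_val r).2))%N.
have IC (x : F) u : I u -> I (x *: u) by rewrite -mul_mpolyC; exact: IM.
(* In the relation of row [r], the left side and all terms with non-constant multipliers involve
   only [h l] of degree below that of [b k], already in [I]. So the part with constant multipliers
   is in [I] too. *)
have relI r : deg r = mdeg (b k) -> I (\sum_l relation_mx r l *: h l).
  rewrite /deg; set i := (enum_val r).1; set k' := (enum_val r).2 => degr.
  have [iM|iM] := pselect (Defs.multiplicative i (b k')).
    by rewrite big1 // => l _; rewrite mxE rel_mul // mcoeff0 scale0r.
  rewrite (_ : \sum_l _ = 'X_i * h k' -
      \sum_l (rel i k' l - (relation_mx r l)%:MP) * h l).
    apply: (idealB iI); first by apply: IM; apply: IH; rewrite -degr in kD.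
    apply: (ideal_sum _ iI) => l _; set u := rel i k' l - _.
    have [->|/mlead_supp cu] := eqVneq u 0; first by rewrite mul0r.
    have c0 : mlead u != 0%MM.
      apply: contraTneq cu => ->.
      by rewrite -mcoeff_eq0 mcoeffB mcoeffC eqxx mulr1 mxE subrr.
    have /rel_deg cD : mlead u \in msupp (rel i k' l).
      move: cu; rewrite !mcoeff_msupp mcoeffB mcoeffC (negPf c0).
      by rewrite mulr0 subr0.
    apply: IM; apply: IH; apply: leq_trans kD.
    rewrite -degr -cD -[X in (X < _)%N]add0n.
    by rewrite ltn_add2r lt0n mdeg_eq0.
  rewrite relE //; under [X in _ - X]eq_bigr do rewrite mulrBl mul_mpolyC.
  by rewrite sumrB subKr.
(* Row [j] of [Y] isolates the pivot [k = f j]. Restricting to rows of the degree of [b k] loses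
   nothing there, as a nonzero entry in column [l] forces [deg r = mdeg (b l)]. *)
pose w l := \sum_(r | deg r == mdeg (b k)) Y j r * relation_mx r l.
have wI : I (\sum_l w l *: h l).
  rewrite (_ : \sum_l _ = \sum_(r | deg r == mdeg (b k))
    Y j r *: (\sum_l relation_mx r l *: h l)).
    by apply: (ideal_sum _ iI) => r /eqP/relI; exact: IC.
  under eq_bigr do rewrite scaler_suml; rewrite exchange_big /=.
  apply: eq_bigr => r _; rewrite scaler_sumr.
  by apply: eq_bigr => l _; rewrite scalerA.
have relD r l : relation_mx r l != 0 -> deg r = mdeg (b l).
  rewrite mxE -mcoeff_msupp => /rel_deg; rewrite mdeg0 add0n => ->.
  by [].
have wf j' : w (f j') = (j == j')%:R *+ (mdeg (b k) == mdeg (b (f j'))).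
  have [kj|kj] := eqVneq (mdeg (b k)) _; last first.
    rewrite /w big1 // => r /eqP degr.
    have [->|/relD] := eqVneq (relation_mx r (f j')) 0; first by rewrite mulr0.
    by move=> rj; rewrite rj in degr; rewrite degr eqxx in kj.
  move/matrixP/(_ j j'): YE; rewrite !mxE => <-.
  rewrite [RHS](bigID (fun r => deg r == mdeg (b k))) /=.
  rewrite [X in _ = _ + X]big1 ?addr0 => [|r degr]; last first.
    rewrite mxE; have [->|/relD rj] := eqVneq (relation_mx r (f j')) 0.
      by rewrite mulr0.
    by rewrite kj rj eqxx in degr.
  by apply: eq_bigr => r _; rewrite !mxE.
(* In this combination [h k] has coefficient 1, the other pivots have coefficient 0, and the
   remaining [h l] belong to [s]. *)
have -> : h k = \sum_l w l *: h l - \sum_(l | l != k) w l *: h l.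
  have wk : w k = 1 by rewrite [X in w X]kf wf -kf !eqxx.
  by rewrite [X in X - _](bigD1 k) //= addrK wk scale1r.
apply: (idealB iI wI); apply: (ideal_sum _ iI) => l lk.
have [/codomP[j' lf]|/sI/IC //] := boolP (l \in codom f).
rewrite lf wf; case: (eqVneq j j') => [jj'|]; last by rewrite mul0rn scale0r.
by rewrite lf kf jj' eqxx in lk.
Qed.

End Relations.

(** * Height and number of generators of primary ideals of the origin *)

Lemma leq_card_indep (F : fieldType) (I M : finType) (G : I -> M -> F) :
  (forall a : I -> F, (forall j, \sum_i a i * G i j = 0) -> forall i, a i = 0) ->
  (#|I| <= #|M|)%N.
Proof.
move=> indep; pose A := \matrix_(i < #|I|, j < #|M|) G (enum_val i) (enum_val j).
suff /eqP <- : row_free A by exact: rank_leq_col.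
rewrite -kermx_eq0; apply/rowV0P => v /sub_kermxP vA.
apply/rowP => k; rewrite mxE -(enum_valK k).
apply: (indep (fun i => v 0 (enum_rank i))) => j.
move/rowP/(_ (enum_rank j)): vA; rewrite !mxE; apply: etrans.
rewrite (reindex _ (onW_bij _ (@enum_val_bij I))) /=.
by apply: eq_bigr => i _; rewrite enum_valK !mxE enum_rankK.
Qed.

Lemma leq_card_span (F : fieldType) (I M : finType) (G : I -> M -> F) :
  (forall j, exists a : I -> F, forall j', \sum_i a i * G i j' = (j == j')%:R) ->
  (#|M| <= #|I|)%N.
Proof.
move=> /choice[a aE].
pose A := \matrix_(i < #|I|, j < #|M|) G (enum_val i) (enum_val j).
pose B := \matrix_(j < #|M|, i < #|I|) a (enum_val j) (enum_val i).
apply: (@mulmx1_min _ _ _ B A); apply/matrixP => j j'.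
rewrite !mxE -(inj_eq enum_val_inj) -aE.
rewrite (reindex _ (onW_bij _ (@enum_val_bij I))) /=.
by apply: eq_bigr => i _; rewrite !mxE.
Qed.

Lemma mnm_le_mdeg n (m : 'X_{1..n}) i : (m i <= mdeg m)%N.
Proof. by rewrite mdegE (bigD1 i) //= leq_addr. Qed.

(** * Degree and order bounds for polynomials *)

Section Degree.
Variables (n : nat) (F : fieldType).
Implicit Types (f g : {mpoly F[n]}) (m : 'X_{1..n}).

Definition deg_le (d : nat) f : Prop :=
  forall m, m \in msupp f -> (mdeg m <= d)%N.
Definition ord_ge (d : nat) f : Prop :=
  forall m, m \in msupp f -> (d <= mdeg m)%N.

Lemma deg_leW d e f : (d <= e)%N -> deg_le d f -> deg_le e f.
Proof. by move=> de fd m /fd/leq_trans; exact. Qed.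

Lemma deg_leM d e f g : deg_le d f -> deg_le e g -> deg_le (d + e) (f * g).
Proof.
move=> fd ge m /msuppM_le/allpairsP[[m1 m2]] /= [/fd m1d /ge m2e ->].
by rewrite mdegD leq_add.
Qed.

Lemma deg_leX d f k : deg_le d f -> deg_le (k * d) (f ^+ k).
Proof.
move=> fd; elim: k => [|k IHk]; last by rewrite exprS mulSn; exact: deg_leM.
by move=> m; rewrite expr0 msupp1 inE => /eqP ->; rewrite mdeg0.
Qed.

Lemma deg_le_msize f : deg_le (msize f) f.
Proof. by move=> m /msize_mdeg_lt/ltnW. Qed.

Lemma ord_ge0 d : ord_ge d 0.
Proof. by move=> m; rewrite msupp0. Qed.

Lemma ord_geD d f g : ord_ge d f -> ord_ge d g -> ord_ge d (f + g).
Proof. by move=> fd gd m /msuppD_le; rewrite mem_cat => /orP[/fd|/gd]. Qed.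

Lemma ord_geZ d a f : ord_ge d f -> ord_ge d (a *: f).
Proof. by move=> fd m /msuppZ_le/fd. Qed.

Lemma ord_geM d e f g : ord_ge d f -> ord_ge e g -> ord_ge (d + e) (f * g).
Proof.
move=> fd ge m /msuppM_le/allpairsP[[m1 m2]] /= [/fd m1d /ge m2e ->].
by rewrite mdegD leq_add.
Qed.

Lemma ord_ge1 f : f@_0 = 0 -> ord_ge 1 f.
Proof.
move=> f0 m; rewrite lt0n mdeg_eq0; apply: contraTneq => ->.
by rewrite mcoeff_msupp f0 eqxx.
Qed.

Lemma ord_ge_mmap1 r (s : 'I_r -> {mpoly F[n]}) (a : 'X_{1..r}) :
  (forall t, (s t)@_0 = 0) -> ord_ge (mdeg a) (mmap1 s a).
Proof.
move=> s0; rewrite mdegE /mmap1.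
apply: (big_ind2 (fun f d => ord_ge d f)) => [m|f d g e|t _] //.
  by move=> *; exact: ord_geM.
elim: (a t) => [|k IHk] //; rewrite exprS.
exact: (ord_geM (ord_ge1 (s0 t)) IHk).
Qed.

End Degree.

(** * Lower bound for the number of generators *)

Section Krull.
Variables (n : nat) (F : fieldType).
Implicit Types (f g : {mpoly F[n]}) (m : 'X_{1..n}).

(* Modulo the k-th power of the maximal ideal, the polynomials are spanned by
   the s^a x^w with exponents of a below k and of w below D: at most
   k ^ r * D ^ n elements, against a dimension of order k ^ n. *)
Lemma min_generators_ge (I : {mpoly F[n]} -> Prop) (D : nat) s :
  (forall m, (D <= mdeg m)%N -> I 'X_[m]) -> (forall f, I f -> f@_0 = 0) ->
  generates s I -> (n <= size s)%N.
Proof.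
move=> ID I0 sI; pose r := size s; pose s_ (t : 'I_r) := tnth (in_tuple s) t.
have s0 t : (s_ t)@_0 = 0.
  by apply/I0/sI; apply: mem_ideal_gen; exact: mem_tnth.
have bound T : (0 < n)%N -> (0 < T)%N -> (T ^ n <= (n * T) ^ r * D ^ n)%N.
  move=> n0 T0; pose k := (n * T)%N.
  pose g (x : {ffun 'I_r -> 'I_k} * {ffun 'I_n -> 'I_D}) : {mpoly F[n]} :=
    mmap1 s_ [multinom x.1 t : nat | t < r] * 'X_[[multinom x.2 i : nat | i < n]].
  pose good f := exists a : _ -> F, ord_ge k (f - \sum_x a x *: g x).
  have good_ord f : ord_ge k f -> good f.
    move=> fk; exists (fun=> 0); rewrite big1 ?subr0 // => x _.
    by rewrite scale0r.
  have goodD f1 f2 : good f1 -> good f2 -> good (f1 + f2).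
    move=> [a1 ak1] [a2 ak2]; exists (fun x => a1 x + a2 x).
    under eq_bigr do rewrite scalerDl.
    by rewrite big_split opprD addrACA; exact: ord_geD.
  have goodZ a f : good f -> good (a *: f).
    move=> [c ck]; exists (fun x => a * c x).
    under eq_bigr do rewrite -scalerA.
    by rewrite -scaler_sumr -scalerBr; exact: ord_geZ.
  (* Induction on [e]. A monomial of degree at least [D] is a combination of the [s_ t], so one more
     factor moves into the power product of [s]; once [mdeg a] reaches [k], the product has order at
     least [k]. *)
  have spank e (a : 'X_{1..r}) f :
      (k <= mdeg a + e)%N -> good (mmap1 s_ a * f).
    have ord0 u : ord_ge (mdeg a) (mmap1 s_ a * u).
      by rewrite -[X in ord_ge X]addn0; apply: ord_geM; first exact: ord_ge_mmap1.
    elim: e a f ord0 => [|e IHe] a f ord0 ka.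
      by apply: good_ord => m /ord0; apply: leq_trans; rewrite addn0 in ka.
    have [ka'|ak] := leqP k (mdeg a).
      by apply: good_ord => m /ord0; apply: leq_trans.
    apply: (@mpoly_comb_ind _ _ (fun u => good (mmap1 s_ a * u))).
    - by rewrite mulr0; apply: good_ord; exact: ord_ge0.
    - by move=> u v; rewrite mulrDr; exact: goodD.
    move=> c m _; rewrite -scalerAr; apply: goodZ.
    have [mD|/ID/sI] := ltnP (mdeg m) D.
      have akt t : (a t < k)%N by apply: leq_ltn_trans ak; exact: mnm_le_mdeg.
      have mDi i : (m i < D)%N by apply: leq_ltn_trans mD; exact: mnm_le_mdeg.
      pose x := ([ffun t => Ordinal (akt t)], [ffun i => Ordinal (mDi i)]).
      have -> : mmap1 s_ a * 'X_[m] = g x.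
        rewrite /g; congr (mmap1 _ _ * 'X_[_]).
          by apply/mnmP => i; rewrite mnmE ffunE.
        by apply/mnmP => i; rewrite mnmE ffunE.
      exists (fun y => (y == x)%:R); rewrite (bigD1 x) //= eqxx scale1r big1.
        by rewrite addr0 subrr; exact: ord_ge0.
      by move=> y /negPf ->; rewrite scale0r.
    move=> /ideal_gen_seqP[u ->]; rewrite mulr_sumr.
    apply: (big_ind good) => [||t _]; first by apply: good_ord; exact: ord_ge0.
      exact: goodD.
    have -> : mmap1 s_ a * (u t * tnth (in_tuple s) t) =
        mmap1 s_ (a + U_(t))%MM * u t.
      rewrite commr_mmap1_M => [|t' y]; last exact: mulrC.
      by rewrite mmap1U -mulrA [_ * u t]mulrC.
    apply: IHe; last by rewrite mdegD mdeg1 -addnA add1n.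
    move=> v; rewrite -[X in ord_ge X]addn0; apply: ord_geM => //.
    exact: ord_ge_mmap1.
  (* Exponents below [T] give degree below [n * T = k], so these [T ^ n] monomials stay independent
     modulo order [k]. *)
  pose mon (w : {ffun 'I_n -> 'I_T}) := [multinom w i : nat | i < n].
  have mon_lt w : (mdeg (mon w) < k)%N.
    have : (\sum_i (w i).+1 <= k)%N.
      apply: (@leq_trans (\sum_(i < n) T)); first exact: leq_sum.
      by rewrite sum_nat_const card_ord.
    under eq_bigr do rewrite -addn1; rewrite big_split sum1_card card_ord /=.
    rewrite mdegE; under [X in (X < _)%N]eq_bigr do rewrite mnmE.
    by apply: leq_trans; rewrite -[X in (X < _)%N]addn0 ltn_add2l.
  have := @leq_card_span F _ _ (fun x w => (g x)@_(mon w)).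
  rewrite card_prod !card_ffun !card_ord; apply=> w.
  have [|a ak] := spank k 0%MM 'X_[mon w]; first by rewrite mdeg0.
  exists a => w'; rewrite mmap11 mul1r in ak.
  have : ('X_[mon w] - \sum_x a x *: g x)@_(mon w') = 0.
    by apply: memN_msupp_eq0; apply: contraL (mon_lt w') => /ak; rewrite -leqNgt.
  rewrite mcoeffB mcoeffX raddf_sum /= => /eqP; rewrite subr_eq0 => /eqP E.
  have -> : (w == w') = (mon w == mon w').
    apply/eqP/eqP => [-> //|/mnmP ww']; apply/ffunP => i; apply: val_inj.
    by have := ww' i; rewrite !mnmE.
  by rewrite E; apply: eq_bigr => x _; rewrite mcoeffZ.
rewrite leqNgt; apply/negP => rn.
(* With [c = n ^ r * D ^ n] the bound reads [T ^ n <= c * T ^ r], which fails at [T = c + 1] when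
   [r < n]. *)
have := bound (n ^ r * D ^ n).+1 (leq_ltn_trans (leq0n _) rn) isT.
rewrite leqNgt expnMn mulnAC => /negP; apply.
set c := (n ^ r * D ^ n)%N.
apply: (@leq_trans (c.+1 ^ r.+1)); last by rewrite leq_pexp2l.
by rewrite expnS ltn_mul2r expn_gt0 /=.
Qed.

End Krull.

Section Kernel.
Variables (A : comNzRingType) (B : idomainType) (phi : {rmorphism A -> B}).

Definition kernel_pred : {pred A} := fun a => phi a == 0.

Fact kernel_idealr : idealr_closed kernel_pred.
Proof.
split; rewrite ?unfold_in ?rmorph0 ?rmorph1 ?oner_eq0 //.
move=> a u v; rewrite !unfold_in rmorphD rmorphM => /eqP -> /eqP ->.
by rewrite mulr0 addr0.
Qed.

Fact kernel_prime : prime_idealr_closed kernel_pred.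
Proof. by move=> u v; rewrite !unfold_in rmorphM mulf_eq0. Qed.

HB.instance Definition _ := isIdealr.Build A kernel_pred kernel_idealr.
HB.instance Definition _ :=
  isPrimeIdealrClosed.Build A kernel_pred kernel_prime.

Definition kernel : prime_idealr A := kernel_pred.

Lemma mem_kernel a : (a \in kernel) = (phi a == 0).
Proof. by []. Qed.

End Kernel.

(** * Chains of primes and the height at the origin *)

Section Height.
Variables (n : nat) (F : fieldType).
Local Notation R := {mpoly F[n]}.
Implicit Types (f g : R) (m : 'X_{1..n}) (p : prime_idealr R).

Definition indep_mod p (I : finType) (g : I -> R) : Prop :=
  forall a : I -> F, \sum_i a i *: g i \in p -> forall i, a i = 0.

Lemma mem_idealZ p (a : F) f : f \in p -> a *: f \in p.
Proof. by rewrite -mul_mpolyC; exact: idealMr. Qed.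

(** Modulo [p2] only the terms with exponent 0 of [f] survive, so their coefficients vanish. The
    rest is divisible by [f], which is cancelled since [p1] is prime. *)
Lemma indep_mod_step p1 p2 f T (I : finType) (g : I -> R) :
  {subset p1 <= p2} -> f \in p2 -> f \notin p1 -> indep_mod p2 g ->
  indep_mod p1 (fun x : 'I_T * I => f ^+ x.1 * g x.2).
Proof.
move=> p12 fp2 fp1 gI; elim: T => [|T IHT] a sum_a [j i]; first by case: j.
pose G := \sum_i a (ord0, i) *: g i.
pose S := \sum_(x : 'I_T * I) a (lift ord0 x.1, x.2) *: (f ^+ x.1 * g x.2).
have sumE : \sum_x a x *: (f ^+ x.1 * g x.2) = G + f * S.
  rewrite (eq_bigr (fun x => a (x.1, x.2) *: (f ^+ x.1 * g x.2))) => [|[] //].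
  rewrite -(pair_bigA _ (fun j i => a (j, i) *: (f ^+ j * g i))) big_ord_recl.
  rewrite /S -(pair_bigA _ (fun j i => a (lift ord0 j, i) *: (f ^+ j * g i))).
  congr (_ + _); first by apply: eq_bigr => i' _; rewrite expr0 mul1r.
  rewrite mulr_sumr; apply: eq_bigr => j' _; rewrite mulr_sumr.
  by apply: eq_bigr => i' _; rewrite -scalerAr exprS mulrA.
have a0 i' : a (ord0, i') = 0.
  apply: (gI (fun i => a (ord0, i))); rewrite -/G.
  have -> : G = (G + f * S) - f * S by rewrite addrK.
  rewrite rpredB //; first by apply: p12; rewrite -sumE.
  by rewrite mulrC idealMr.
have G0 : G = 0 by apply: big1 => i' _; rewrite a0 scale0r.
move: sum_a; rewrite sumE G0 add0r prime_idealrM (negPf fp1) /= => Sp.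
have {}IHT := IHT (fun x => a (lift ord0 x.1, x.2)) Sp.
case: (unliftP ord0 j) => [j' ->|-> //]; exact: (IHT (j', i)).
Qed.

(** Each inclusion supplies a polynomial whose powers below [T] multiply the number of independent
    elements by [T], while the degrees grow only linearly in [T]. *)
Lemma prime_chain_indep h (c : nat -> prime_idealr R) :
  (forall i, (i < h)%N -> prime_lt (c i) (c i.+1)) ->
  exists D, forall T, (0 < T)%N -> exists (I : finType) (g : I -> R),
    [/\ #|I| = (T ^ h)%N, forall i, deg_le (D * T) (g i) & indep_mod (c 0%N) g].
Proof.
elim: h c => [|h IHh] c chain.
  exists 0%N => T T0; exists unit, (fun=> 1); split=> [|_ m|a].
  - by rewrite card_unit.
  - by rewrite msupp1 inE => /eqP ->; rewrite mdeg0.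
  - rewrite (bigD1 tt) //= big1 ?addr0 => [a1 []|[] //]; apply/eqP.
    apply/negPn/negP => a0; suff : 1 \in c 0%N by rewrite idealr1.
    by rewrite -[1](scale1r 1) -(mulVf a0) -scalerA mem_idealZ.
have [D IHD] := IHh (c \o succn) (fun i ih => chain i.+1 ih).
have [c01 /existsNP[f /not_implyP[fc1 /negP fc0]]] := chain 0%N isT.
exists (msize f + D)%N => T T0; have [I [g [cardI gD gI]]] := IHD T T0.
exists ('I_T * I)%type, (fun x : 'I_T * I => f ^+ x.1 * g x.2); split.
- by rewrite card_prod card_ord cardI expnS.
- move=> [j i] /=; rewrite mulnDl; apply: deg_leM _ (gD i).
  apply: deg_leW _ (deg_leX (@deg_le_msize _ _ f)).
  by rewrite mulnC leq_mul2l ltnW ?orbT.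
- exact: (indep_mod_step c01).
Qed.

(** A chain of length [h] gives [T ^ h] independent polynomials of degree at most [D * T], in a
    space of dimension at most [(D * T + 1) ^ n]. *)
Lemma prime_chain_le p h : prime_chain p h -> (h <= n)%N.
Proof.
move=> [c [_ /prime_chain_indep[D cD]]]; rewrite leqNgt; apply/negP => nh.
(* Chosen so that [(D * T + 1) ^ n <= (D + 1) ^ n * T ^ n < T ^ n.+1 <= T ^ h]. *)
pose T := ((D + 1) ^ n).+1.
have [I [g [cardI gD gI]]] := cD T isT.
have := @leq_card_indep F I {ffun 'I_n -> 'I_(D * T).+1}
  (fun i w => (g i)@_[multinom w j : nat | j < n]).
rewrite cardI card_ffun !card_ord => bound.
suff /bound : forall a : I -> F, (forall w : {ffun 'I_n -> 'I_(D * T).+1},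
    \sum_i a i * (g i)@_[multinom w j : nat | j < n] = 0) -> forall i, a i = 0.
  rewrite leqNgt => /negP; apply; apply: (@leq_ltn_trans ((D + 1) ^ n * T ^ n)).
    rewrite -expnMn; case: (posnP n) => [-> //|n0].
    by rewrite leq_exp2r // mulnDl mul1n -addn1 leq_add2l.
  apply: (@leq_trans (T ^ n.+1)); last by rewrite leq_pexp2l.
  by rewrite expnS ltn_mul2r expn_gt0 /=.
move=> a a0.
  apply: gI; rewrite (_ : \sum_i _ = 0) ?idealr0 //.
  apply/mpolyP => m; rewrite mcoeff0.
  have [mD|Dm] := leqP (mdeg m) (D * T).
    have mDi j : (m j < (D * T).+1)%N by exact: leq_trans (mnm_le_mdeg m j) mD.
    rewrite -[RHS](a0 [ffun j => Ordinal (mDi j)]) raddf_sum.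
    apply: eq_bigr => i _; rewrite /= mcoeffZ; congr (_ * _@__).
    by apply/mnmP => j; rewrite mnmE ffunE.
  rewrite raddf_sum big1 // => i _ /=; rewrite mcoeffZ memN_msupp_eq0 ?mulr0 //.
  by apply: contraL Dm => /gD; rewrite -leqNgt.
Qed.

Lemma mem_prime_origin p : (forall i, 'X_i \in p) ->
  forall f, (f \in p) = (f@_0 == 0).
Proof.
move=> Xp f; have fp : f - (f@_0)%:MP \in p.
  apply: (@mpoly_comb_ind _ _ (fun u => u - (u@_0)%:MP \in p)).
  - by rewrite mcoeff0 subr0 idealr0.
  - by move=> u v up vp; rewrite mcoeffD mpolyCD opprD addrACA rpredD.
  move=> a m _; rewrite mcoeffZ mcoeffX; have [->|m0] := eqVneq m 0%MM.
    by rewrite mpolyX0 mulr1 -alg_mpolyC subrr idealr0.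
  have /existsP[i mi] : [exists i, m i != 0%N].
    apply: contra_neqT m0 => /existsPn m0; apply/mnmP => i.
    by rewrite mnm0E; apply/eqP/negbNE.
  have -> : 'X_[m] = 'X_[m - U_(i)] * 'X_i :> R.
    by rewrite -mpolyXD submK ?lep1mP.
  by rewrite mulr0 subr0 mem_idealZ // idealMr.
apply/idP/eqP => [pf|f0]; last by rewrite f0 subr0 in fp.
have : (f@_0)%:MP \in p by rewrite -(subKr f (_%:MP)) rpredB.
have [->//|a0] := eqVneq f@_0 0.
move=> /(mem_idealZ (f@_0)^-1); rewrite -mul_mpolyC -mpolyCM mulVf // mpolyC1.
by rewrite idealr1.
Qed.

Lemma eq_rmorph_mpoly (S : comNzRingType) (phi psi : {rmorphism R -> S}) :
  (forall a, phi a%:MP = psi a%:MP) -> (forall i, phi 'X_i = psi 'X_i) ->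
  phi =1 psi.
Proof.
move=> eqC eqX f; rewrite [f]mpolyE !rmorph_sum; apply: eq_bigr => m _.
rewrite -mul_mpolyC !rmorphM eqC mpolyXE_id !rmorph_prod; congr (_ * _).
by apply: eq_bigr => i _; rewrite !rmorphXn /= eqX.
Qed.

Lemma ex_kill_vars (k : nat) : exists phi : {rmorphism R -> R},
  (forall a, phi a%:MP = a%:MP) /\
  forall i : 'I_n, phi 'X_i = if (i < k)%N then 0 else 'X_i.
Proof.
exists (mmap (@mpolyC n F) (fun i : 'I_n => if (i < k)%N then 0 else 'X_i)).
by split=> [a|i] /=; rewrite ?mmapC ?mmapX ?mmap1U.
Qed.

(** The chain (0), (x_0), (x_0, x_1), ... is realized by kernels of substitutions killing the first
    [k] variables; they are prime because the target is a domain. *)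
Lemma ex_prime_chain : exists c : nat -> prime_idealr R,
  (forall i, 'X_i \in c n) /\ forall k, (k < n)%N -> prime_lt (c k) (c k.+1).
Proof.
have /choice[phi phiP] := ex_kill_vars.
exists (fun k => kernel (phi k)); split=> [i|k kn].
  by rewrite mem_kernel (phiP n).2 ltn_ord.
have phi_comp f : phi k.+1 (phi k f) = phi k.+1 f.
  apply: (eq_rmorph_mpoly
    (phi := (phi k.+1 \o phi k : {rmorphism R -> R}))) => [a|i] /=.
    by rewrite (phiP k).1.
  rewrite (phiP k).2; case: ltnP => // ik.
  by rewrite rmorph0 (phiP k.+1).2 ltnS ltnW.
split=> [f|/(_ 'X_(Ordinal kn))]; rewrite !mem_kernel.
  by rewrite -(phi_comp f) => /eqP ->; rewrite rmorph0.
rewrite (phiP k).2 (phiP k.+1).2 ltnS leqnn ltnn eqxx.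
by move/(_ isT); rewrite -msize_poly_eq0 msizeX.
Qed.

Lemma prime_height_origin p : (forall i, 'X_i \in p) -> prime_height p n.
Proof.
move=> Xp; split=> [|k]; last exact: prime_chain_le.
have [c [cX clt]] := ex_prime_chain; exists c; split=> // f.
by rewrite (mem_prime_origin Xp) (mem_prime_origin cX).
Qed.

(** A prime over [I] contains every variable, hence is the maximal ideal of the origin, which does
    contain [I]. *)
Lemma ideal_height_origin (I : R -> Prop) h :
  (forall i, exists e, I ('X_i ^+ e)) -> (forall f, I f -> f@_0 = 0) ->
  ideal_height I h <-> h = n.
Proof.
move=> IX I0; have over p : prime_over I p -> forall i, 'X_i \in p.
  move=> Ip i; have [e /Ip] := IX i.
  elim: e => [|e IHe]; first by rewrite expr0 idealr1.
  by rewrite exprS prime_idealrM => /orP[].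
have heightE p k : prime_over I p -> prime_height p k -> k = n.
  move=> /over/prime_height_origin[np max_n] [kp max_k].
  by apply/eqP; rewrite eqn_leq max_n // max_k.
split=> [[[p Ip pk] _]|->]; first exact: heightE Ip pk.
split=> [|p k Ip pk]; last by rewrite (heightE _ _ Ip pk).
have [c [/[dup] cX /prime_height_origin cn _]] := ex_prime_chain.
by exists (c n) => // f If; rewrite (mem_prime_origin cX) I0.
Qed.

End Height.

(** * The marked scheme *)

(** Turns the rank bound into an open condition. The selections [f] and [g] may be arbitrary maps,
    since a repeated row or column makes the determinant zero. *)
Lemma rank_minors (F : fieldType) m n (A : 'M[F]_(m, n)) (r : nat) :
  (r <= \rank A)%N <-> exists s (f : 'I_s -> 'I_m) (g : 'I_s -> 'I_n),
    (r <= s)%N /\ \det (mxsub f g A) != 0.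
Proof.
have mxsubE s (f : 'I_s -> 'I_m) (g : 'I_s -> 'I_n) :
    mxsub f g A = (rowsub g (rowsub f A)^T)^T.
  by apply/matrixP => i j; rewrite !mxE.
split=> [rA|[s [f [g [rs]]]]]; last first.
  rewrite -unitfE -unitmxE -row_free_unit mxsubE => /eqP rk_s.
  apply: leq_trans rs _; rewrite -{1}rk_s mxrank_tr.
  apply: leq_trans (mxrankS (rowsub_sub _ _)) _.
  by rewrite mxrank_tr mxrankS ?rowsub_sub.
have full : row_full (rowsub (maxrankfun A) A)^T.
  by rewrite /row_full mxrank_tr; exact: maxrowsub_free.
exists (\rank A), (maxrankfun A), (fullrankfun full); split=> //.
by rewrite mxsubE -unitfE -unitmxE unitmx_tr fullrowsub_unit.
Qed.

Section Pommaret.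
Variables (K : fieldType) (n : nat) (J : {mpoly K[n.+1]} -> Prop).
Variable P : {fset 'X_{1..n.+1}}.
Implicit Types (d e m t : 'X_{1..n.+1}) (i : 'I_n.+1).
Hypothesis PB : pommaret_basis J P.

Definition basis_term (k : 'I_(size P)) : 'X_{1..n.+1} := tnth (in_tuple P) k.
Local Notation b := basis_term.
Definition mem_term m : Prop := J 'X_[m].

Lemma basis_termP t : reflect (exists k, t = b k) (t \in P).
Proof.
by apply: (iffP idP) => [/seq_tnthP[k ->]|[k ->]]; [exists k | exact: mem_tnth].
Qed.

Lemma basis_term_inj : injective b.
Proof. by apply/(@tuple_uniqP _ _ (in_tuple P)); exact: fset_uniq. Qed.

Lemma big_basis (V : nmodType) (G : 'X_{1..n.+1} -> V) :
  \sum_(a <- P) G a = \sum_k G (b k).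
Proof. exact: big_tnth. Qed.

(* Every term is multiplied into the complement of the finite set P by a power
   of x_0, which is multiplicative for all terms. *)
Lemma pommaret_cones : cone_partition mem_term b.
Proof.
have [JE cones] := PB; have [_ _ JM] := pommaret_basis_ideal PB.
have Jb k : mem_term (b k).
  by apply/JE; apply: mem_ideal_gen; exists (b k) => //; exact: mem_tnth.
have JD m d : mem_term m -> mem_term (d + m)%MM.
  by move=> Jm; rewrite /mem_term mpolyXD; exact: JM.
split=> // [t Jt|k l d e E dM eM].
  have [/basis_termP[k ->]|/(cones _ Jt)[_ [[/basis_termP[k ->]]]]] :=
    boolP (t \in P).
    by exists k, 0%MM; rewrite add0m; split=> //; exact: multiplicative_term0.
  by move=> [d -> dM] _; exists k, d.
(* The exponent exceeds the degree of every term of [P]. *)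
pose x0 := (U_(ord0 : 'I_n.+1) *+ (\sum_(a <- P) mdeg a).+1)%MM.
have x0M d' k' : multiplicative_term d' (b k') ->
    multiplicative_term (x0 + d') (b k').
  move=> d'M i; rewrite mnmDE mulmnE mnm1E.
  by have [<- _ j|_ /d'M] := eqVneq ord0 i.
have tP : (x0 + (d + b k))%MM \notin P.
  apply/negP => /basis_termP[k' E'].
  have := congr1 (@mdeg _) E'; rewrite mdegD mdegMn mdeg1 mul1n big_basis.
  by rewrite (bigD1 k') //=; lia.
have [s [_ sU]] := cones _ (JD _ x0 (JD _ d (Jb k))) tP.
have Es k' d' : (d + b k = d' + b k')%MM -> multiplicative_term d' (b k') ->
    s = b k'.
  move=> E' d'M; apply: sU; split; first exact: mem_tnth.
  by exists (x0 + d')%MM; [rewrite E' addmA | exact: x0M].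
by apply: basis_term_inj; rewrite -(Es k d) // (Es l e).
Qed.

Lemma mem_tails m a : m \in tails J a -> ~ mem_term m /\ mdeg m = mdeg a.
Proof. by rewrite mem_filter => /andP[/andP[/eqP -> /asboolP]]. Qed.

Lemma generic_marked_set :
  marked_set mem_term b (fun k => generic_marked J P (b k)).
Proof.
move=> k m; rewrite subKr => /msupp_sum_le/flattenP[_ /mapP[j jP ->]].
move=> /msuppZ_le; rewrite msuppX inE => /eqP ->.
move: jP; rewrite mem_filter => /andP[/eqP <- _].
have : coef_at j \in coef_index J P by exact: mem_tnth.
by case/allpairsPdep => a [e [aP /mem_tails eT ->]].
Qed.

Section Artinian.
Hypothesis artJ : artinian_quotient J.

(** The chain of ideals J + (x_i^k) stabilizes, so x_i^e lies in J + (x_i^(e+1)) for some [e]. Then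
    x_i^e occurs in an element of [J], hence belongs to [J]. *)
Lemma mem_power i : exists e : nat, mem_term (U_(i) *+ e)%MM.
Proof.
have iJ := pommaret_basis_ideal PB; have [J0 JD JM] := iJ.
pose L k f := exists u v, J u /\ f = u + 'X_[U_(i) *+ k] * v.
case: (artJ (L := L)) => [k|k f Jf|k f [u [v [Ju ->]]]|e /(_ e.+1 (leqnSn e))].
- split=> [|f g [u [v [Ju ->]]] [u' [v' [Ju' ->]]]|f g [u [v [Ju ->]]]].
  + by exists 0, 0; rewrite mulr0 addr0.
  + by exists (u + u'), (v + v'); split; [exact: JD | rewrite mulrDr addrACA].
  + exists (f * u), (f * v); split; first exact: JM.
    by rewrite mulrDr !mulrA [f * 'X_[_]]mulrC.
- by exists f, 0; rewrite mulr0 addr0.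
- exists u, ('X_i * v); split=> //.
  by rewrite mulrA -mpolyXD -mulmSr.
move=> /(_ 'X_[U_(i) *+ e])[_ []].
  by exists 0, 1; rewrite mulr1 add0r.
move=> u [v [Ju /(congr1 (mcoeff (U_(i) *+ e)%MM))]].
rewrite mcoeffD mcoeffX eqxx (memN_msupp_eq0 (p := _ * v)) ?addr0.
  move=> u1; exists e; apply: (pommaret_basis_msupp PB Ju).
  by rewrite mcoeff_msupp -u1 oner_eq0.
apply/negP => /msuppM_le/allpairsP[[m1 m2]] /= [].
rewrite msuppX inE => /eqP -> _ /mnmP/(_ i).
by rewrite mnmDE !mulmnE mnm1E eqxx; lia.
Qed.

Lemma mem_large_degree : exists D, forall m, (D <= mdeg m)%N -> mem_term m.
Proof.
have [_ _ JM] := pommaret_basis_ideal PB.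
have /choice[e eP] := mem_power; exists (\sum_i e i).+1 => m mD.
have [i im] : exists i, (e i <= m i)%N.
  apply/not_existsP => mlt; move: mD; rewrite ltnNge mdegE => /negP; apply.
  by apply: leq_sum => i _; apply: ltnW; rewrite ltnNge; apply/negP/mlt.
have -> : m = (m - U_(i) *+ e i + U_(i) *+ e i)%MM.
  rewrite submK //; apply/mnm_lepP => j; rewrite mulmnE mnm1E.
  by case: eqP => [<-|_]; rewrite ?mul1n ?mul0n.
by rewrite /mem_term mpolyXD; exact/JM/eP.
Qed.

End Artinian.
End Pommaret.

(** * Relations over K[C] and their specialization at points *)

Section Locus.
Variables (K : fieldType) (n : nat) (J : {mpoly K[n.+1]} -> Prop).
Variable P : {fset 'X_{1..n.+1}}.
Implicit Types (d e m t : 'X_{1..n.+1}) (i : 'I_n.+1).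
Hypotheses (PB : pommaret_basis J P) (artJ : artinian_quotient J).
Local Notation b := (basis_term (P := P)).
Local Notation H k := (generic_marked J P (b k)).
Local Notation A0 := {mpoly K[size (coef_index J P)]}.

Lemma standard_remainder_basis (q : 'I_(size P) -> {mpoly A0[n.+1]}) f g :
  (forall k c, c \in msupp (q k) -> multiplicative_term c (b k)) ->
  (forall m, m \in msupp g -> nonmember J m) ->
  f = \sum_k q k * H k + g ->
  standard_remainder P (nonmember J) (generic_marked J P) f g.
Proof.
move=> qM gN fE; pose q' a := if [pick k | b k == a] is Some k then q k else 0.
exists q'; split=> // [a d _|].
  by rewrite /q'; case: pickP => [k /eqP <-|_]; [exact: qM | rewrite msupp0].
rewrite fE big_basis; congr (_ + _); apply: eq_bigr => k _; congr (_ * _).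
rewrite /q'; case: pickP => [l /eqP/basis_term_inj -> //|/(_ k)].
by rewrite eqxx.
Qed.

(** The relations are chosen once over K[C], so that one matrix serves all points. Their remainders
    have coefficients in the ideal of the scheme and vanish after specialization. *)
Lemma generic_relations : exists
    (rel : 'I_n.+1 -> 'I_(size P) -> 'I_(size P) -> {mpoly A0[n.+1]})
    (rem : 'I_n.+1 -> 'I_(size P) -> {mpoly A0[n.+1]}),
  [/\ forall i k, ~ Defs.multiplicative i (b k) ->
        'X_i * H k = \sum_l rel i k l * H l + rem i k,
      forall i k l c, c \in msupp (rel i k l) -> lex_lt c U_(i)%MM /\
        (mdeg c + mdeg (b l) = 1 + mdeg (b k))%N,
      forall i k l, Defs.multiplicative i (b k) -> rel i k l = 0
    & forall i k m, marked_relations (rem i k)@_m].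
Proof.
have [U0 UD UM] := marked_relations_ideal J P.
pose rem_ok i k (x : ('I_(size P) -> {mpoly A0[n.+1]}) * {mpoly A0[n.+1]}) :=
  [/\ ~ Defs.multiplicative i (b k) -> 'X_i * H k = \sum_l x.1 l * H l + x.2,
      forall l c, c \in msupp (x.1 l) -> lex_lt c U_(i)%MM /\
        (mdeg c + mdeg (b l) = 1 + mdeg (b k))%N,
      Defs.multiplicative i (b k) -> forall l, x.1 l = 0
    & forall m, marked_relations x.2@_m].
suff /choice[F FP] (ik : 'I_n.+1 * 'I_(size P)) : exists x, rem_ok ik.1 ik.2 x.
  exists (fun i k => (F (i, k)).1), (fun i k => (F (i, k)).2).
  split=> [i k|i k l c|i k l|i k m]; case: (FP (i, k)) => relE relP rel0 remP //.
  - exact: relP.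
  - by move=> /rel0.
case: ik => i k /=; have [iM|iM] := pselect (Defs.multiplicative i (b k)).
  exists (fun=> 0, 0); split=> //= [l c|m]; first by rewrite msupp0.
  by rewrite mcoeff0.
have [q [g [qP gP E]]] := std_repM_head (pommaret_cones PB)
  (generic_marked_set (J := J) (P := P)) iM.
exists (q, g); split=> //= [l c /qP[]//|m].
apply: mem_ideal_gen; exists i, (b k), g, m; split=> //; first exact: mem_tnth.
by apply: (standard_remainder_basis _ _ E) => [l c /qP[]|m' /gP[]].
Qed.

Section Specialization.
Variables (F : fieldType) (phi : {rmorphism A0 -> F}).
Hypothesis phiU : forall c, marked_relations c -> phi c = 0.
Local Notation h k := (map_mpoly phi (H k)).

Lemma specialized_marked_set : marked_set (mem_term J) b (fun k => h k).
Proof.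
move=> k m; rewrite -(map_mpolyX phi) -rmorphB => mh.
apply: (@generic_marked_set _ _ _ P k m); apply: contraLR mh.
by rewrite -!mcoeff_eq0 mcoeff_map_mpoly => /eqP ->; apply/eqP; exact: rmorph0.
Qed.

Local Notation I := (marked_ideal (fun k => h k)).

(** In degrees where all terms lie in [J], a standard representation has no remainder. *)
Lemma specialized_pure_powers : exists D, forall m, (D <= mdeg m)%N -> I 'X_[m].
Proof.
have [D DJ] := mem_large_degree PB artJ; exists D => m Dm.
have [q [g [_ gP ->]]] := std_rep_mpolyX (pommaret_cones PB)
  specialized_marked_set m.
have -> : g = 0.
  apply: msuppnil0; case E: (msupp g) => [//|c r].
  have /gP[Nc cm] : c \in msupp g by rewrite E mem_head.
  by case: Nc; apply: DJ; rewrite cm.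
by rewrite addr0; apply/ideal_gen_finP; exists q.
Qed.

Lemma specialized_origin : 0%MM \notin P -> forall f, I f -> f@_0 = 0.
Proof.
move=> P0; apply: ideal_gen_min => [|_ [k ->]].
  split=> [|f g f0 g0|f g g0]; first exact: mcoeff0.
    by rewrite mcoeffD f0 g0 addr0.
  by rewrite rmorphM /= g0 mulr0.
have bk0 : b k != 0%MM by apply: contraNneq P0 => <-; exact: mem_tnth.
rewrite -[h k](subKr 'X_[b k]) mcoeffB mcoeffX (negPf bk0) sub0r.
rewrite memN_msupp_eq0 ?oppr0 //; apply/negP => /specialized_marked_set[_].
by rewrite mdeg0 => /esym/eqP; rewrite mdeg_eq0 (negPf bk0).
Qed.

Lemma specialized_unit : 0%MM \in P -> I 1.
Proof.
move=> /basis_termP[k k0]; suff <- : h k = 1 by apply: mem_ideal_gen; exists k.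
suff tail0 : 'X_[b k] - h k = 0.
  by rewrite -[h k](subKr 'X_[b k]) tail0 subr0 -k0 mpolyX0.
apply: msuppnil0; case E: (msupp _) => [//|c r].
have /specialized_marked_set[Nc] : c \in msupp ('X_[b k] - h k).
  by rewrite E mem_head.
rewrite -k0 mdeg0 => /eqP; rewrite mdeg_eq0 => /eqP c0; case: Nc.
by rewrite c0 k0; case: (pommaret_cones PB).
Qed.

Variable rel : 'I_n.+1 -> 'I_(size P) -> 'I_(size P) -> {mpoly A0[n.+1]}.
Variable rem : 'I_n.+1 -> 'I_(size P) -> {mpoly A0[n.+1]}.
Hypothesis relE : forall i k, ~ Defs.multiplicative i (b k) ->
  'X_i * H k = \sum_l rel i k l * H l + rem i k.
Hypothesis relP : forall i k l c, c \in msupp (rel i k l) ->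
  lex_lt c U_(i)%MM /\ (mdeg c + mdeg (b l) = 1 + mdeg (b k))%N.
Hypothesis rel0 : forall i k l, Defs.multiplicative i (b k) -> rel i k l = 0.
Hypothesis remP : forall i k m, marked_relations (rem i k)@_m.

(** The height is [n.+1], and at least that many generators are needed. The least number of
    generators is [size P] minus the rank, so equality amounts to [size P <= n.+1 + rank], which is
    what the truncated subtraction encodes. *)
Lemma complete_intersection_rank : 0%MM \notin P ->
  complete_intersection I <->
  (size P - n.+1 <= \rank (map_mx phi (relation_matrix rel)))%N.
Proof.
move=> P0; pose rel' i k l := map_mpoly phi (rel i k l).
have -> : map_mx phi (relation_matrix rel) = relation_matrix rel'.
  by apply/matrixP => r l; rewrite !mxE mcoeff_map_mpoly.
have relE' i k : ~ Defs.multiplicative i (b k) ->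
    'X_i * h k = \sum_l rel' i k l * h l.
  move=> /relE/(congr1 (map_mpoly phi)); rewrite rmorphM /= map_mpolyX => ->.
  rewrite rmorphD rmorph_sum /= [map_mpoly phi (rem i k)](_ : _ = 0) ?addr0.
    by apply: eq_bigr => l _; rewrite rmorphM.
  apply/mpolyP => m; rewrite mcoeff_map_mpoly mcoeff0.
  by apply: phiU; exact: remP.
have relP' i k l c : c \in msupp (rel' i k l) ->
    lex_lt c U_(i)%MM /\ (mdeg c + mdeg (b l) = 1 + mdeg (b k))%N.
  move=> cr; apply: relP; apply: contraLR cr.
  by rewrite -!mcoeff_eq0 mcoeff_map_mpoly => /eqP ->; apply/eqP; exact: rmorph0.
have rel0' i k l : Defs.multiplicative i (b k) -> rel' i k l = 0.
  by move=> /rel0 r0; rewrite /rel' r0 rmorph0.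
have [D DI] := specialized_pure_powers; have I0 := specialized_origin P0.
have IX i : exists e : nat, I ('X_i ^+ e).
  by exists D; rewrite mpolyXn; apply: DI; rewrite mdegMn mdeg1 mul1n.
have min_ge := min_generators_ge DI I0.
have heightE r := ideal_height_origin r IX I0.
have rk_le := generates_rank (pommaret_cones PB) specialized_marked_set
  relE' (fun i k l c cr => (relP' i k l c cr).1).
split=> [[_ [r [[s sr sI] _] /heightE rn]]|rk].
  by rewrite leq_subLR; move: (rk_le _ sI); rewrite sr rn.
split=> [/I0|]; first by move/eqP; rewrite mcoeff1 eqxx oner_eq0.
have [s sE sI] := rank_generates relE'
  (fun i k l c cr => (relP' i k l c cr).2) rel0'.
exists n.+1; last exact/heightE.
split=> //; exists s => //; apply/eqP; rewrite eqn_leq min_ge // andbT.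
by move: rk; rewrite leq_subLR -[X in (X <= _)%N]sE leq_add2r.
Qed.

End Specialization.
End Locus.

Lemma residue_map_eq0 (A : comNzRingType) (p : prime_idealr A) a :
  (residue_map p a == 0) = (a \in p).
Proof.
by rewrite /residue_map /= tofrac_eq0 -[a in RHS]subr0 Quotient.idealrBE rmorph0.
Qed.

Lemma quotient_map_eq0 (A : comNzRingType) (I : A -> Prop) (iI : is_ideal I)
    (I1 : ~ I 1) a : I a -> quotient_map iI I1 a = 0.
Proof.
move=> Ia; rewrite -(rmorph0 (quotient_map iI I1)); apply/eqP.
by rewrite -Quotient.idealrBE subr0; apply/asboolP.
Qed.

Theorem corollary6p17 (K : fieldType) (n : nat)
    (J : {mpoly K[n.+1]} -> Prop) (monJ : monomial_ideal J)
    (artJ : artinian_quotient J)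
    (P : {fset 'X_{1..n.+1}}) (PB : pommaret_basis J P) :
  zariski_open (@ci_locus K n J P PB).
Proof.
pose b := basis_term (P := P).
pose phi p := (residue_map p \o marked_ring_map PB : {rmorphism _ -> _}).
have phiU (p : prime_idealr (marked_ring PB)) c :
    marked_relations c -> phi p c = 0.
  move=> cU; have c0 : marked_ring_map PB c = 0 by exact: quotient_map_eq0.
  by rewrite /phi /= c0 (rmorph0 (residue_map p)).
have idealE p : point_ideal (p := p) =
    marked_ideal (fun k => map_mpoly (phi p) (generic_marked J P (b k))).
  congr ideal_gen; apply/funext => f; apply/propext; split.
    by case=> a /basis_termP[k ->] ->; exists k.
  by case=> k ->; exists (b k) => //; exact: mem_tnth.
have [P0|P0] := boolP (0%MM \in P).
  (* Every point ideal is the unit ideal, so the complement of the locus is the whole space, V of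
     the empty set. *)
  exists (fun=> False) => p; split=> [_ a []|_ [I1 _]]; apply: I1.
  by rewrite idealE; exact: (specialized_unit PB).
have [rel [rem [relE relP rel0 remP]]] := generic_relations PB.
pose Theta := map_mx (marked_ring_map PB) (relation_matrix rel).
(* The complement is cut out by all minors of Theta of size at least [size P - n.+1]; a minor is
   nonzero at [p] exactly when it is not in [p]. *)
exists (fun a => exists s (f : 'I_s -> _) (g : 'I_s -> _),
  (size P - n.+1 <= s)%N /\ a = \det (mxsub f g Theta)) => p.
have ciE : ci_locus p <-> exists s (f : 'I_s -> _) (g : 'I_s -> _),
    (size P - n.+1 <= s)%N /\ \det (mxsub f g Theta) \notin p.
  rewrite /ci_locus idealE (complete_intersection_rank PB artJ (phiU p) relE) //.
  have minorE s f g :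
      (\det (mxsub f g (map_mx (phi p) (relation_matrix rel)) : 'M_s)
        == 0) = (\det (mxsub f g Theta) \in p).
    by rewrite map_mx_comp -map_mxsub det_map_mx; exact: residue_map_eq0.
  rewrite rank_minors; split=> -[s [f [g [rs]]]].
    by rewrite minorE => ?; exists s, f, g.
  by rewrite -minorE => ?; exists s, f, g.
split=> [nci _ [s [f [g [rs ->]]]]|pE /ciE[s [f [g [rs /negP]]]]].
  by apply: contra_notT nci => np; apply/ciE; exists s, f, g.
by apply; apply: pE; exists s, f, g.
Qed.
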